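(* Let $r\ge1$ and let $F_{2,r}\colon M_r\to M_r$ be the scalar dilation of the $(2r+1)$-dimensional integral Heisenberg nilmanifold induced by $(u,v,c)\mapsto(2u,2v,4c)$. Its complete visibility and index-mass profiles are $$\mathcal V_{F_{2,r}}(B)=\begin{cases}1,&B<3^{2r+1},\\3,&B\ge3^{2r+1},\end{cases}\qquad\text{and}\qquad \mathcal M_{F_{2,r}}(B)=3\quad(B\ge1).$$ Thus no finite observer sees exactly two of the three essential Nielsen classes (i.e. $V_N(F_{2,r})\neq2$ for every finite observer $N$). In particular $$\mathrm{dc}(F_{2,r})=\mathrm{cfc}(F_{2,r})=1,\qquad \mathrm{oc}(F_{2,r})=3^{2r+1}.$$
   Context: Heisenberg nilmanifolds. $\mathbb H_r(\mathbb Z)=\mathbb Z^r\times\mathbb Z^r\times\mathbb Z$ with $(u,v,c)(u',v',c')=(u+u',v+v',c+c'-u'\cdot v)$; $\mathbb H_r(\mathbb R)$ is defined by the same formula over $\mathbb R$, and $M_r=\mathbb H_r(\mathbb Z)\backslash\mathbb H_r(\mathbb R)$. The given endomorphism preserves the lattice and induces $F_{2,r}$. General definitions. For a self-map $f\colon X\to X$ of a finite connected CW complex, $G=\pi_1(X,x_0)$, a choice of lift $\tilde f$ of $f$ to the universal cover $p\colon\tilde X\to X$ determines $\phi\in\mathrm{End}(G)$ with $\tilde f(g\tilde x)=\phi(g)\tilde f(\tilde x)$. Write $a\sim_\phi b$ if $b=ga\phi(g)^{-1}$ for some $g\in G$; $\mathcal R(\phi)$ is the set of classes. The Reidemeister trace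 is $\mathrm{RT}(f)=\sum_{\alpha}I_f(\alpha)[\alpha]\in\mathbb Z[\mathcal R(\phi)]$, where for $\alpha=[a]$, $I_f(\alpha)$ is the fixed-point index of the fixed-point class $p(\mathrm{Fix}(a\tilde f))$; its finite support is $E_f$. A finite observer is a finite-index normal subgroup $N\triangleleft G$ with $\phi(N)\subseteq N$; with $q_N\colon G\to G/N$ and induced $\bar\phi_N$, it gives $(q_N)_R\colon\mathcal R(\phi)\to\mathcal R(\bar\phi_N)$, $[a]\mapsto[q_N(a)]$, and the observed trace $\mathrm{RT}_N(f)$ is the pushforward of $\mathrm{RT}(f)$ along $(q_N)_R$. Put $V_N(f)=\#\mathrm{supp}\,\mathrm{RT}_N(f)$ and $M_N(f)=\|\mathrm{RT}_N(f)\|_1$ (sum of absolute values of coefficients). For $B\in\mathbb N$, $\mathcal V_f(B)$ and $\mathcal M_f(B)$ are the maxima of $V_N(f)$ and $M_N(f)$, respectively, over finite observers $N$ with $[G:N]\le B$. Further, $\mathrm{dc}(f)$, $\mathrm{cfc}(f)$, $\mathrm{oc}(f)$ are the minima of $[G:N]$ over finite observers $N$ with, respectively, $\mathrm{RT}_N(f)\neq0$; $M_N(f)=\|\mathrm{RT}(f)\|_1$; $(q_N)_R|_{E_f}$ injective (each $\infty$ if no such $N$ exists). *)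

(* Defs.v *)
From HB Require Import structures.
From mathcomp Require Import all_boot all_order all_algebra finmap.
From mathcomp Require Import all_classical all_reals all_analysis.
From mathcomp Require Import ring.

Set Implicit Arguments.
Unset Strict Implicit.
Unset Printing Implicit Defensive.

Import Order.TTheory GRing.Theory Num.Theory.
Import numFieldNormedType.Exports.

Local Open Scope classical_set_scope.
Local Open Scope ring_scope.
Local Open Scope quotient_scope.

(** * Extrema of sets of natural numbers *)

(* The maximum of [S], and 0 when there is none. *)
Definition max_nat (S : set nat) : nat :=
  xget 0%N [set m | S m /\ forall n, S n -> (n <= m)%N].

(* The minimum of [S] in [nat] extended by infinity; [None] stands for infinity
   and is the value on the empty set. *)
Definition min_nat (S : set nat) : option nat :=
  if pselect (exists n, S n) then
    Some (xget 0%N [set m | S m /\ forall n, S n -> (m <= n)%N])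
  else None.

(** * The free abelian group on a set, as integer-valued functions *)

Section FreeAbelian.
Variables K L : choiceType.
Implicit Types (t : K -> int) (h : K -> L).

Definition supp t : set K := [set a | t a != 0].

(* [fset_set] and sums [\sum_(_ \in _)] are meaningful for finite supports, which
   is the case of elements of the free abelian group. *)
Definition card_supp t : nat := #|` fset_set (supp t)|.

Definition norm1 t : nat := (\sum_(a \in [set: K]) `|t a|)%N.

Definition pushforward h t : L -> int :=
  fun b => \sum_(a \in h @^-1` [set b]) t a.

End FreeAbelian.

(** * Reidemeister classes *)

Lemma group_hom_monoid (G H : groupType) (f : G -> H) :
  {morph f : x y / (x * y)%g} -> monoid.monoid_morphism f.
Proof.
by move=> fM; split=> //; apply: (mulgI (f 1%g)); rewrite -fM !mulg1.
Qed.

Section Reidemeister.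
Variables (G : groupType) (phi : UMagmaMorphism.type G G).
Local Open Scope group_scope.

Definition twisted_conj (a b : G) : Prop := exists g : G, b = g * a * (phi g)^-1.

Lemma twisted_conj_refl a : twisted_conj a a.
Proof. by exists 1; rewrite gmulf1 invg1 mul1g mulg1. Qed.

Lemma twisted_conj_sym a b : twisted_conj a b -> twisted_conj b a.
Proof.
case=> g ->; exists g^-1.
by rewrite gmulfV invgK !mulgA mulVg mul1g -mulgA mulVg mulg1.
Qed.

Lemma twisted_conj_trans a b c :
  twisted_conj a b -> twisted_conj b c -> twisted_conj a c.
Proof.
by case=> g -> [k ->]; exists (k * g); rewrite gmulfM invgM !mulgA.
Qed.

Lemma twisted_conj_equiv :
  equiv_class_of (fun a b : G => `[< twisted_conj a b >]).
Proof.
split=> [a|a b|b a c]; first exact/asboolP/twisted_conj_refl.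
  by apply/asboolP/asboolP; apply: twisted_conj_sym.
move=> /asboolP ab /asboolP bc; apply/asboolP; exact: twisted_conj_trans bc.
Qed.

Definition twisted_conj_rel : equiv_rel G := EquivRelPack twisted_conj_equiv.

Definition reidemeister : choiceType := {eq_quot twisted_conj_rel}.

Definition reidemeister_class (a : G) : reidemeister :=
  \pi_({eq_quot twisted_conj_rel}) a.

Definition reidemeister_repr (x : reidemeister) : G :=
  repr (x : {eq_quot twisted_conj_rel}).

Lemma reidemeister_reprK x : reidemeister_class (reidemeister_repr x) = x.
Proof. exact: reprK. Qed.

Lemma reidemeister_classP a b :
  reidemeister_class a = reidemeister_class b <-> twisted_conj a b.
Proof.
by split=> [/eqmodP/asboolP //|ab]; apply/eqmodP/asboolP.
Qed.

End Reidemeister.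

(** * Quotient groups *)

Section Quotient.
Variable G : groupType.
Local Open Scope group_scope.

Record normal_subgroup := NormalSubgroup {
  normal_set :> G -> Prop;
  normal_set1 : normal_set 1;
  normal_setM : forall x y, normal_set x -> normal_set y -> normal_set (x * y);
  normal_setV : forall x, normal_set x -> normal_set x^-1;
  normal_setJ : forall x g, normal_set x -> normal_set (g * x * g^-1) }.

Variable N : normal_subgroup.

Lemma coset_equiv : equiv_class_of (fun a b : G => `[< N (a^-1 * b) >]).
Proof.
split=> [a|a b|b a c]; first by apply/asboolP; rewrite mulVg; exact: normal_set1.
  by apply/asboolP/asboolP => /normal_setV; rewrite invgM invgK.
move=> /asboolP ab /asboolP bc; apply/asboolP.
by have := normal_setM ab bc; rewrite -mulgA mulVKg.
Qed.

Definition coset_rel : equiv_rel G := EquivRelPack coset_equiv.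

Definition quotient_group : Type := {eq_quot coset_rel}.
HB.instance Definition _ := Choice.on quotient_group.
HB.instance Definition _ := EqQuotient.on quotient_group.

Definition quotient_map (a : G) : quotient_group := \pi a.

Lemma quotient_mapP a b : quotient_map a = quotient_map b <-> N (a^-1 * b).
Proof. by split=> [/eqmodP/asboolP //|ab]; apply/eqmodP/asboolP. Qed.

Lemma quotient_map_repr x : quotient_map (repr x) = x.
Proof. exact: reprK. Qed.

Definition quotient_mul (x y : quotient_group) := quotient_map (repr x * repr y).
Definition quotient_inv (x : quotient_group) := quotient_map (repr x)^-1.

Lemma quotient_mulE a b :
  quotient_mul (quotient_map a) (quotient_map b) = quotient_map (a * b).
Proof.
apply/quotient_mapP.
have /quotient_mapP Na := quotient_map_repr (quotient_map a).
have /quotient_mapP Nb := quotient_map_repr (quotient_map b).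
set a' := repr (quotient_map a) in Na *; set b' := repr (quotient_map b) in Nb *.
have -> : (a' * b')^-1 * (a * b) = b'^-1 * (a'^-1 * a) * b'^-1^-1 * (b'^-1 * b).
  by rewrite invgK invgM !mulgA mulgK.
by apply: normal_setM => //; apply: normal_setJ.
Qed.

Lemma quotient_invE a : quotient_inv (quotient_map a) = quotient_map a^-1.
Proof.
apply/quotient_mapP.
have /quotient_mapP Na := quotient_map_repr (quotient_map a).
set a' := repr (quotient_map a) in Na *.
have -> : a'^-1^-1 * a^-1 = a' * (a'^-1 * a)^-1 * a'^-1.
  by rewrite invgM !invgK !mulgA mulgK.
by apply: normal_setJ; apply: normal_setV.
Qed.

Lemma quotient_mulA : associative quotient_mul.
Proof.
move=> x y z.
rewrite -(quotient_map_repr x) -(quotient_map_repr y) -(quotient_map_repr z).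
by rewrite !quotient_mulE mulgA.
Qed.

Lemma quotient_mul1 : left_id (quotient_map 1) quotient_mul.
Proof. by move=> x; rewrite -(quotient_map_repr x) quotient_mulE mul1g. Qed.

Lemma quotient_mulr1 : right_id (quotient_map 1) quotient_mul.
Proof. by move=> x; rewrite -(quotient_map_repr x) quotient_mulE mulg1. Qed.

Lemma quotient_mulV : left_inverse (quotient_map 1) quotient_inv quotient_mul.
Proof.
by move=> x; rewrite -(quotient_map_repr x) quotient_invE quotient_mulE mulVg.
Qed.

Lemma quotient_mulrV : right_inverse (quotient_map 1) quotient_inv quotient_mul.
Proof.
by move=> x; rewrite -(quotient_map_repr x) quotient_invE quotient_mulE mulgV.
Qed.

HB.instance Definition _ := isGroup.Build quotient_group
  quotient_mulA quotient_mul1 quotient_mulr1 quotient_mulV quotient_mulrV.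

Lemma quotient_mapM a b :
  quotient_map (a * b) = (quotient_map a * quotient_map b)%g.
Proof. by rewrite -quotient_mulE. Qed.

(* The index [G : N] when it is finite. *)
Definition group_index : nat := #|` fset_set [set: quotient_group]|.

End Quotient.

(** * Finite observers *)

Section Observer.
Variables (G : groupType) (phi : UMagmaMorphism.type G G).

Record observer := Observer {
  observer_group :> normal_subgroup G;
  observer_finite : finite_set [set: quotient_group observer_group];
  observer_stable : forall x, observer_group x -> observer_group (phi x) }.

Section Induced.
Variable N : observer.
Local Notation q := (@quotient_map G N).

Definition induced_hom (x : quotient_group N) : quotient_group N :=
  q (phi (repr x)).

Lemma induced_homE a : induced_hom (q a) = q (phi a).
Proof.
apply/quotient_mapP; rewrite -gmulfV -gmulfM; apply: observer_stable.
exact/quotient_mapP/quotient_map_repr.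
Qed.

Lemma induced_hom_multiplicative x y :
  induced_hom (x * y)%g = (induced_hom x * induced_hom y)%g.
Proof.
rewrite -(quotient_map_repr x) -(quotient_map_repr y).
by rewrite -quotient_mapM !induced_homE gmulfM quotient_mapM.
Qed.

HB.instance Definition _ := isUMagmaMorphism.Build
  (quotient_group N) (quotient_group N) induced_hom
  (group_hom_monoid induced_hom_multiplicative).

Definition observe (x : reidemeister phi) : reidemeister induced_hom :=
  reidemeister_class induced_hom (q (reidemeister_repr x)).

Lemma observeE a :
  observe (reidemeister_class phi a) = reidemeister_class induced_hom (q a).
Proof.
apply/reidemeister_classP.
have /reidemeister_classP := reidemeister_reprK (reidemeister_class phi a).
set b := reidemeister_repr _ => -[g ->]; exists (q g).
by rewrite !quotient_mapM -quotient_invE -induced_homE.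
Qed.

End Induced.
Arguments induced_hom N x : clear implicits.
Arguments observe N x : clear implicits.

(* The trace [t], an element of the free abelian group on the Reidemeister
   classes of [phi], is a parameter of the invariants below. *)
Variable t : reidemeister phi -> int.

Definition observed_trace (N : observer) : reidemeister (induced_hom N) -> int :=
  pushforward (observe N) t.
Arguments observed_trace N b : clear implicits.

Definition visibility (N : observer) : nat := card_supp (observed_trace N).

Definition index_mass (N : observer) : nat := norm1 (observed_trace N).

Definition visibility_profile (B : nat) : nat :=
  max_nat [set visibility N | N in [set N : observer | (group_index N <= B)%N]].

Definition mass_profile (B : nat) : nat :=
  max_nat [set index_mass N | N in [set N : observer | (group_index N <= B)%N]].

Definition min_index (P : set observer) : option nat :=
  min_nat [set group_index N | N in P].

Definition dc : option nat :=
  min_index [set N | exists b, observed_trace N b != 0].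

Definition cfc : option nat :=
  min_index [set N | index_mass N = norm1 t].

Definition oc : option nat :=
  min_index [set N | {in supp t &, injective (observe N)}].

End Observer.

(** * The fixed-point index *)

Section Index.
Variables (R : realType) (X : topologicalType).

Definition admissible (f : X -> X) (U : set X) : Prop :=
  [/\ open U, {within U, continuous f} & compact [set x | U x /\ f x = x]].

(* On a finite-dimensional manifold without boundary, such as a nilmanifold,
   there is exactly one fixed-point index, and it is characterized by the
   following axioms (Furi, Pera, Spadini, "On the uniqueness of the fixed point
   index on differentiable manifolds", 2004).  Only the values [fp_index f U] with
   [admissible f U] are constrained; they depend only on [f] restricted to [U],
   by [index_homotopy]. *)
Record fixed_point_index := FixedPointIndex {
  fp_index :> (X -> X) -> set X -> int;
  index_normalization : forall c : X, fp_index (fun=> c) setT = 1;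
  index_additivity : forall (f : X -> X) (U U1 U2 : set X),
    admissible f U -> open U1 -> open U2 -> U1 `<=` U -> U2 `<=` U ->
    U1 `&` U2 = set0 -> [set x | U x /\ f x = x] `<=` U1 `|` U2 ->
    fp_index f U = fp_index f U1 + fp_index f U2;
  index_homotopy : forall (h : X * R -> X) (U : set X),
    open U -> {within U `*` `[0, 1], continuous h} ->
    compact [set z : X * R | [/\ U z.1, 0 <= z.2 <= 1 & h z = z.1]] ->
    fp_index (fun x => h (x, 0)) U = fp_index (fun x => h (x, 1)) U }.

(* The index of an isolated set [S] of fixed points of [f] is the index of [f]
   on an open neighbourhood of [S] containing no other fixed point. *)
Definition isolated_index (ind : fixed_point_index) (f : X -> X) (S : set X) :
    int :=
  ind f (xget set0 [set U | open U /\ [set x | U x /\ f x = x] = S]).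

End Index.

(** * The Reidemeister trace *)

(* [p : Xt -> X] is the universal cover, [act] the action of the deck group [G],
   and [ft] a lift of [f] with [ft (act g x) = act (phi g) (ft x)].  For the
   dilation below, these hypotheses on the lift are [nil_dilationE] and
   [heis_dilation_equivariant], and [nil_projP] identifies the fibres of the
   projection with the orbits of the lattice. *)
Section Trace.
Variables (R : realType) (X : topologicalType) (ind : fixed_point_index R X).
Variables (Xt : Type) (p : Xt -> X) (G : groupType) (act : G -> Xt -> Xt).
Variables (phi : UMagmaMorphism.type G G) (f : X -> X) (ft : Xt -> Xt).

Definition fixed_point_class (a : G) : set X :=
  p @` [set x | act a (ft x) = x].

Definition reidemeister_trace (x : reidemeister phi) : int :=
  isolated_index ind f (fixed_point_class (reidemeister_repr x)).

End Trace.

(** * Heisenberg groups *)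

Definition heis (A : Type) (r : nat) : Type := ('rV[A]_r * 'rV[A]_r * A)%type.

Section HeisGroup.
Variables (A : comNzRingType) (r : nat).
Local Notation H := (heis A r).

HB.instance Definition _ := Choice.copy H ('rV[A]_r * 'rV[A]_r * A)%type.

Definition dot (u v : 'rV[A]_r) : A := \sum_(i < r) u 0 i * v 0 i.

Definition heis_mul (x y : H) : H :=
  let: (u, v, c) := x in let: (u', v', c') := y in
  (u + u', v + v', c + c' - dot u' v).

Definition heis_one : H := (0, 0, 0).

Definition heis_inv (x : H) : H :=
  let: (u, v, c) := x in (- u, - v, - c - dot u v).

Lemma dotDl u u' v : dot (u + u') v = dot u v + dot u' v.
Proof.
by rewrite /dot -big_split; apply: eq_bigr => i _; rewrite mxE mulrDl.
Qed.

Lemma dotDr u v v' : dot u (v + v') = dot u v + dot u v'.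
Proof.
by rewrite /dot -big_split; apply: eq_bigr => i _; rewrite mxE mulrDr.
Qed.

Lemma dotZl a u v : dot (a *: u) v = a * dot u v.
Proof. by rewrite /dot mulr_sumr; apply: eq_bigr => i _; rewrite mxE mulrA. Qed.

Lemma dotZr a u v : dot u (a *: v) = a * dot u v.
Proof. by rewrite /dot mulr_sumr; apply: eq_bigr => i _; rewrite mxE mulrCA. Qed.

Lemma dot0l v : dot 0 v = 0.
Proof. by rewrite -(scale0r 0) dotZl mul0r. Qed.

Lemma dot0r v : dot v 0 = 0.
Proof. by rewrite -(scale0r 0) dotZr mul0r. Qed.

Lemma dotNl u v : dot (- u) v = - dot u v.
Proof. by rewrite -scaleN1r dotZl mulN1r. Qed.

Lemma dotNr u v : dot u (- v) = - dot u v.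
Proof. by rewrite -scaleN1r dotZr mulN1r. Qed.

Lemma heis_mulA : associative heis_mul.
Proof.
move=> [[u v] c] [[u' v'] c'] [[u'' v''] c''] /=; congr (_, _, _).
- by rewrite addrA.
- by rewrite addrA.
- by rewrite dotDl dotDr; ring.
Qed.

Lemma heis_mul1 : left_id heis_one heis_mul.
Proof. by move=> [[u v] c] /=; rewrite dot0r subr0 !add0r. Qed.

Lemma heis_mulr1 : right_id heis_one heis_mul.
Proof. by move=> [[u v] c] /=; rewrite dot0l subr0 !addr0. Qed.

Lemma heis_mulV : left_inverse heis_one heis_inv heis_mul.
Proof.
move=> [[u v] c] /=; rewrite !addNr; congr (_, _, _).
by rewrite dotNr opprK addrAC subrK addNr.
Qed.

Lemma heis_mulrV : right_inverse heis_one heis_inv heis_mul.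
Proof.
move=> [[u v] c] /=; rewrite !subrr; congr (_, _, _).
by rewrite dotNl opprK addrA addrNK subrr.
Qed.

HB.instance Definition _ := isGroup.Build H
  heis_mulA heis_mul1 heis_mulr1 heis_mulV heis_mulrV.

Definition heis_dilation (x : H) : H :=
  let: (u, v, c) := x in (2 *: u, 2 *: v, 4 * c).

Lemma heis_dilation_multiplicative x y :
  heis_dilation (x * y)%g = (heis_dilation x * heis_dilation y)%g.
Proof.
case: x y => [[u v] c] [[u' v'] c'].
rewrite /heis_dilation -![(_ * _)%g]/(heis_mul _ _) /=; congr (_, _, _).
- by rewrite scalerDr.
- by rewrite scalerDr.
- by rewrite dotZl dotZr mulrA mulrBr mulrDr -natrM.
Qed.

HB.instance Definition _ := isUMagmaMorphism.Build H H
  heis_dilation (group_hom_monoid heis_dilation_multiplicative).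

End HeisGroup.

HB.instance Definition _ (R : realType) (r : nat) :=
  Topological.copy (heis R r) ('rV[R]_r * 'rV[R]_r * R)%type.

(** * Heisenberg nilmanifolds *)

Section Nilmanifold.
Variables (R : realType) (r : nat).

Definition heis_incl (g : heis int r) : heis R r :=
  let: (u, v, c) := g in (map_mx intr u, map_mx intr v, c%:~R).

Lemma dot_intr (u v : 'rV[int]_r) :
  dot (map_mx intr u : 'rV[R]_r) (map_mx intr v) = (dot u v)%:~R.
Proof.
by rewrite /dot rmorph_sum; apply: eq_bigr => i _; rewrite !mxE rmorphM.
Qed.

Lemma heis_inclM g h : heis_incl (g * h)%g = (heis_incl g * heis_incl h)%g.
Proof.
case: g h => [[u v] c] [[u' v'] c']; rewrite -![(_ * _)%g]/(heis_mul _ _) /=.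
by rewrite !map_mxD dot_intr rmorphB rmorphD.
Qed.

HB.instance Definition _ := isUMagmaMorphism.Build
  (heis int r) (heis R r) heis_incl (group_hom_monoid heis_inclM).

Definition lattice_act (g : heis int r) (x : heis R r) : heis R r :=
  (heis_incl g * x)%g.

Lemma heis_dilation_incl g :
  heis_dilation (heis_incl g) = heis_incl (heis_dilation g).
Proof.
case: g => [[u v] c] /=; rewrite /heis_dilation /=; congr (_, _, _).
- by apply/rowP => i; rewrite !mxE rmorphM.
- by apply/rowP => i; rewrite !mxE rmorphM.
- by rewrite rmorphM.
Qed.

Lemma heis_dilation_equivariant g x :
  heis_dilation (lattice_act g x) = lattice_act (heis_dilation g) (heis_dilation x).
Proof.
by rewrite /lattice_act heis_dilation_multiplicative heis_dilation_incl.
Qed.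

Lemma same_orbit_equiv :
  equiv_class_of (fun x y : heis R r => `[< exists g, y = lattice_act g x >]).
Proof.
rewrite /lattice_act; split=> [x|x y|y x z].
- by apply/asboolP; exists 1%g; rewrite gmulf1 mul1g.
- by apply/asboolP/asboolP => -[g ->]; exists g^-1%g; rewrite gmulfV mulKg.
- move=> /asboolP[g ->] /asboolP[h ->]; apply/asboolP; exists (h * g)%g.
  by rewrite gmulfM mulgA.
Qed.

Definition same_orbit : equiv_rel (heis R r) := EquivRelPack same_orbit_equiv.

(* The set of right cosets of the lattice, with the quotient topology. *)
Definition nilmanifold : Type := quotient_topology {eq_quot same_orbit}.
HB.instance Definition _ := Topological.on nilmanifold.

Definition nil_proj (x : heis R r) : nilmanifold := \pi_({eq_quot same_orbit}) x.

Definition nil_repr (m : nilmanifold) : heis R r :=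
  repr (m : {eq_quot same_orbit}).

Lemma nil_reprK m : nil_proj (nil_repr m) = m.
Proof. exact: reprK. Qed.

Lemma nil_projP x y : nil_proj x = nil_proj y <-> exists g, y = lattice_act g x.
Proof. by split=> [/eqmodP/asboolP //|xy]; apply/eqmodP/asboolP. Qed.

Definition nil_dilation (m : nilmanifold) : nilmanifold :=
  nil_proj (heis_dilation (nil_repr m)).

Lemma nil_dilationE x : nil_dilation (nil_proj x) = nil_proj (heis_dilation x).
Proof.
apply/esym/nil_projP.
have /esym/nil_projP [g ->] := nil_reprK (nil_proj x).
by exists (heis_dilation g); rewrite heis_dilation_equivariant.
Qed.

(* The Reidemeister trace of the dilation of the nilmanifold, with respect to
   the lift [heis_dilation] to the universal cover [heis R r]. *)
Definition dilation_trace (ind : fixed_point_index R nilmanifold) :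
    reidemeister (@heis_dilation int r) -> int :=
  @reidemeister_trace R nilmanifold ind (heis R r) nil_proj (heis int r)
    lattice_act (@heis_dilation int r) nil_dilation (@heis_dilation R r).

End Nilmanifold.

(* Main.v *)
Require Import Defs.
From HB Require Import structures.
From mathcomp Require Import all_boot all_order all_algebra finmap.
From mathcomp Require Import all_classical all_reals all_analysis.
From mathcomp Require Import ring lra zify.

Set Implicit Arguments.
Unset Strict Implicit.
Unset Printing Implicit Defensive.

Import Order.TTheory GRing.Theory Num.Theory.
Import numFieldNormedType.Exports.

Local Open Scope classical_set_scope.
Local Open Scope ring_scope.

(* The fixed points of the lift [a D] form a single point [x_a], and the chart
   [y |-> proj (x_a * y)] conjugates the nilmanifold map near [proj x_a] to the
   dilation [D]; so each Nielsen class is one point with the local index of a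
   linear expansion of [R^(2r+1)].  This index is [-1]: rotating [(u, v)] in
   [W * W] turns the [2r] expanding directions into contracting ones, and a fold
   cancels the last expansion against a contraction, whose index is 1.

   Writing [kappa (p, q, s) = s - p.q mod 3], the twisted conjugacy classes are the
   fibres of [kappa], so there are three of them.  The centre permutes them
   transitively and compatibly with every observer, hence an observer separates
   all three or none.  If [N] separates them then [kappa] vanishes on [N]; applied
   to conjugates of [n = (p, q, s)] in [N] this gives [a.q = p.b mod 3] for all
   [a, b], so that [n = 0 mod 3], whence the index is at least [3^(2r+1)], with
   equality for the kernel of the reduction mod 3. *)

(** * Consequences of the index axioms *)

Section IndexProperties.
Variables (R : realType) (X : topologicalType) (ind : fixed_point_index R X).

(** Additivity with all three sets empty reads [i = i + i]. *)
Lemma index_set0 (f : X -> X) : ind f set0 = 0.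
Proof.
have adm : admissible f set0.
  split; first exact: open0; first exact: continuous_subspace0.
  rewrite (_ : mkset _ = set0); first exact: compact0.
  by apply/seteqP; split=> x [].
have := index_additivity ind adm open0 open0 (@subset_refl _ _) (@subset_refl _ _).
by rewrite setI0 => /(_ erefl) H; have := H ltac:(by move=> x []); lia.
Qed.

(** Additivity with the empty set as second piece. *)
Lemma index_excision (f : X -> X) (U U' : set X) :
  admissible f U -> open U' -> U' `<=` U ->
  [set x | U x /\ f x = x] `<=` U' -> ind f U = ind f U'.
Proof.
move=> adm oU' U'U fixU'.
rewrite (index_additivity ind adm oU' open0 U'U) ?setI0 ?setU0 //.
by rewrite index_set0 addr0.
Qed.

Lemma index_cst (c : X) (U : set X) : open U -> U c -> ind (fun=> c) U = 1.
Proof.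
move=> oU Uc; rewrite -(index_normalization ind c); apply/esym.
apply: index_excision => //; last by move=> x [_ /= <-].
split; first exact: openT.
  by apply: continuous_subspaceT => x; exact: cvg_cst.
rewrite [X in compact X](_ : _ = [set c]); first exact: compact_set1.
by apply/seteqP; split=> [x [_ <-]|x ->].
Qed.

(** The neighbourhood picked by [xget] does not matter: two isolating neighbourhoods are both
    excised to their intersection, which contains the same fixed points. *)
Lemma isolated_indexE (f : X -> X) (U S : set X) :
  open U -> continuous f -> compact S -> [set x | U x /\ f x = x] = S ->
  isolated_index ind f S = ind f U.
Proof.
move=> oU cf cS fixU; rewrite /isolated_index.
case: xgetP => [V _ [oV fixV]|/(_ U)/= H]; last by case: H.
have admS W : open W -> [set x | W x /\ f x = x] = S -> admissible f W.
  by move=> oW fixW; split=> //; [exact: continuous_subspaceT|rewrite fixW].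
have oVU : open (V `&` U) by exact: openI.
have VU x : f x = x -> V x <-> U x.
  move=> fx; have := congr1 (fun A => A x) (etrans fixV (esym fixU)).
  by rewrite /= => E; split=> [Vx|Ux]; [have [] : U x /\ f x = x by rewrite -E
    | have [] : V x /\ f x = x by rewrite E].
transitivity (ind f (V `&` U)).
  apply: index_excision (admS V oV fixV) oVU (@subIsetl _ _ _) _.
  by move=> x [Vx fx]; split=> //; apply/VU.
apply/esym/(index_excision (admS U oU fixU) oVU (@subIsetr _ _ _)).
by move=> x [Ux fx]; split=> //; apply/VU.
Qed.

End IndexProperties.

(** * Computing the index through an open map from a normed space *)

Section Chart.
Variables (R : realType) (X : topologicalType) (ind : fixed_point_index R X).
Variables (V : normedModType R) (psi : V -> X).
Hypothesis psi_continuous : continuous psi.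
Hypothesis psi_open : forall A, open A -> open (psi @` A).

Definition represents (U : set V) (f : X -> X) (phi : V -> V) : Prop :=
  forall y, U y -> f (psi y) = psi (phi y).

Definition chart_inv (U : set V) (x : X) : V := xget 0 (U `&` psi @^-1` [set x]).

Lemma chart_invK U y : set_inj U psi -> U y -> chart_inv U (psi y) = y.
Proof.
move=> inj Uy; rewrite /chart_inv; case: xgetP => [z _ [Uz /= e]|/(_ y)/= H].
  by apply: inj => //; rewrite ?inE.
by case: H.
Qed.

(** Any [phi] is thus realised by a map of [X]. Off the image of [U] that map takes the default
    value [psi (phi 0)], which continuity within the image ignores. *)
Lemma represents_chart_inv U phi :
  set_inj U psi -> represents U (psi \o phi \o chart_inv U) phi.
Proof. by move=> inj y Uy; rewrite /= chart_invK. Qed.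

(** As [psi] is open, it sends neighbourhoods of [y] in [U] to neighbourhoods of [psi y]; continuity
    of [psi \o h] is transported along them. *)
Lemma continuous_homotopy_in_chart (U : set V) (h : V * R -> V) (H : X * R -> X) :
  open U -> continuous h ->
  (forall y (t : R), U y -> 0 <= t <= 1 -> H (psi y, t) = psi (h (y, t))) ->
  {within (psi @` U) `*` `[0, 1], continuous H}.
Proof.
move=> oU ch HE; apply/subspace_continuousP => -[_ t] /= [[y Uy <-]].
rewrite /= in_itv /= => t01; rewrite /from_subspace HE //.
move=> O /= nO.
have /= : nbhs (y, t) ((psi \o h) @^-1` O).
  apply: (@continuous_comp _ _ _ h psi) => //; [exact: ch|exact: psi_continuous].
move=> [[A B] /= [nA nB] AB].
exists (psi @` (A° `&` U), B) => /=.
  split=> //; apply: open_nbhs_nbhs; split.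
    by apply: psi_open; apply: openI => //; exact: open_interior.
  by exists y => //; split.
move=> [x s] /= [[z [Az Uz] <-] Bs] [_ ]; rewrite in_itv /= => s01.
by rewrite HE //; apply: (AB (z, s)); split=> //=; exact: interior_subset.
Qed.

Lemma continuous_in_chart (U : set V) (phi : V -> V) (f : X -> X) :
  open U -> continuous phi -> represents U f phi ->
  {within psi @` U, continuous f}.
Proof.
move=> oU cphi rep; have oV := psi_open oU.
(* The homotopy constant in time, to be read off at time 0. *)
have := @continuous_homotopy_in_chart U (phi \o fst) (f \o fst) oU.
have ch : continuous (phi \o (@fst V R)).
  by move=> z; apply: continuous_comp; [exact: cvg_fst|exact: cphi].
move=> /(_ ch) H.
have {}H : {within (psi @` U) `*` `[0, 1], continuous (f \o (@fst X R))}.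
  by apply: H => y t Uy _; rewrite /= rep.
apply/subspace_continuousP => x Ux; move/subspace_continuousP: H => /(_ (x, 0)).
rewrite /= in_itv /= lexx ler01 => /(_ (conj Ux isT)) H O /= /H.
move=> [[A B] /= [nA nB] AB].
apply: filterS nA => z Az Uz; apply: (AB (z, 0)) => /=.
  by split=> //; exact: nbhs_singleton.
by split=> //; rewrite in_itv /= lexx ler01.
Qed.

Lemma admissible_in_chart (U : set V) (phi : V -> V) (f : X -> X) (K : set V) :
  open U -> continuous phi -> represents U f phi -> compact K -> K `<=` U ->
  (forall y, U y -> psi (phi y) = psi y <-> K y) ->
  admissible f (psi @` U).
Proof.
move=> oU cphi rep cK KU fixK; split; first exact: psi_open.
  exact: continuous_in_chart rep.
rewrite [X in compact X](_ : _ = psi @` K).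
  by apply: continuous_compact => //; exact: continuous_subspaceT.
apply/seteqP; split=> [_ [[y Uy <-]]|_ [y Ky <-]].
  by rewrite rep // => /fixK Ky; exists y => //; exact: Ky.
by split; [exists y => //; exact: KU|rewrite rep; [apply/fixK => //|]; exact: KU].
Qed.

(** The condition on [psi (h (y, t))] rules out fixed points that arise because [psi] identifies two
    points, so the fixed points of the homotopy are those of [h]. The compact set [K] only has to
    contain them. *)
Lemma index_homotopy_in_chart (U : set V) (h : V * R -> V) (f g : X -> X)
    (K : set V) :
  open U -> continuous h -> compact K -> K `<=` U -> set_inj U psi ->
  (forall y (t : R), U y -> 0 <= t <= 1 ->
     psi (h (y, t)) = psi y -> h (y, t) = y /\ K y) ->
  represents U f (fun y => h (y, 0)) -> represents U g (fun y => h (y, 1)) ->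
  ind f (psi @` U) = ind g (psi @` U).
Proof.
move=> oU ch cK KU inj fixh rf rg.
(* The homotopy axiom compares functions on all of [X], so [H] is made equal to [f] and [g] at its
   two ends; the chart formula is used only in between. *)
pose H (z : X * R) := if z.2 == 0 then f z.1 else if z.2 == 1 then g z.1 else
  psi (h (chart_inv U z.1, z.2)).
have HE y t : U y -> H (psi y, t) = psi (h (y, t)).
  move=> Uy; rewrite /H /=; case: eqVneq => [->|_]; first by rewrite rf.
  by case: eqVneq => [->|_]; [rewrite rg|rewrite chart_invK].
have -> : f = fun x => H (x, 0) by apply/funext => x; rewrite /H /= eqxx.
have -> : g = fun x => H (x, 1).
  by apply/funext => x; rewrite /H /= eqxx oner_eq0.
apply: index_homotopy; first exact: psi_open.
  by apply: continuous_homotopy_in_chart oU ch _ => y t Uy _; exact: HE.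
(* The fixed points of [h] form a closed subset of the product of [K] with the unit interval; its
   image under [psi] and the identity is the compact set required. *)
pose E := (K `*` `[0, 1]) `&` [set z : V * R | h z - z.1 = 0].
have cE : compact E.
  apply: compact_closedI.
    by apply: compact_setX => //; exact: segment_compact.
  rewrite [X in closed X](_ : _ = (fun z => `|h z - z.1|) @^-1` [set 0]).
apply: (@closed_comp _ _ (fun z : V * R => `|h z - z.1|) [set 0]); last first.
      exact: closed_eq.
    move=> z _; apply: cvg_norm; apply: cvgB; [exact: ch|exact: cvg_fst].
  by apply/seteqP; split=> z /= => [->|/eqP]; rewrite ?normr0 // normr_eq0 => /eqP.
rewrite [X in compact X](_ : _ = (fun z => (psi z.1, z.2)) @` E).
  apply: continuous_compact => //; apply: continuous_subspaceT => z.
  apply: (@cvg_pair _ _ _ (nbhs z) (nbhs (psi z.1)) (nbhs z.2)); last exact: cvg_snd.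
  by apply: continuous_comp; [exact: cvg_fst|exact: psi_continuous].
apply/seteqP; split=> [[_ t] /= [[y Uy <-] t01]|].
  rewrite HE // => /fixh [] // hy Ky; exists (y, t) => //=.
  by split=> /=; [split=> //=; rewrite in_itv|rewrite hy subrr].
move=> _ [[y t] [[/= Ky t01] /= /subr0_eq hy] <-] /=.
have Uy := KU _ Ky; rewrite HE // hy; split=> //; by exists y.
Qed.

End Chart.

(** * The index of a linear dilation *)

Section LocalIndex.
Variables (R : realType) (X : topologicalType) (ind : fixed_point_index R X).
Variables (W : normedModType R).
Local Notation V := (W * W * R)%type.
Variable psi : V -> X.
Hypothesis psi_continuous : continuous psi.
Hypothesis psi_open : forall A, open A -> open (psi @` A).

Definition box (rho : R) : set V :=
  [set y | [/\ `|y.1.1| < rho, `|y.1.2| < rho & `|y.2| < rho]].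

Hypothesis psi_inj : set_inj (box 2^-1) psi.

Lemma open_box rho : open (box rho).
Proof.
rewrite (_ : box rho = [set y : V | `|y.1.1| < rho] `&`
   ([set y : V | `|y.1.2| < rho] `&` [set y : V | `|y.2| < rho])); last first.
  by apply/seteqP; split=> y /=; [case|case=> ? []].
have opn (T : normedModType R) (q : V -> T) : continuous q ->
    open [set y : V | `|q y| < rho].
  move=> cq; apply: (@open_comp _ _ (fun y => `|q y|) [set x | x < rho]).
    by move=> y _; apply: cvg_norm; exact: cq.
  exact: open_lt.
apply: openI; [|apply: openI].
- by apply: opn => y; apply: continuous_comp; exact: cvg_fst.
- by apply: opn => y; apply: continuous_comp; [exact: cvg_fst|exact: cvg_snd].
- by apply: (opn (R : normedModType R)) => y; exact: cvg_snd.
Qed.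

(** Radius 1/10 keeps the images of [U] under the homotopies below inside the box of radius 1/2,
    where [psi] is injective; the sharpest demand is the factor 4 on the last coordinate. *)
Let U := box 10^-1.

Lemma box_tenth_half : U `<=` box 2^-1.
Proof. by move=> y [*]; split; lra. Qed.

Let psi_injU : set_inj U psi.
Proof.
by move=> x y; rewrite !inE => /box_tenth_half ? /box_tenth_half ?;
  apply: psi_inj; rewrite inE.
Qed.

Lemma psi_fixed y z : U y -> box 2^-1 z -> psi z = psi y -> z = y.
Proof. by move=> /box_tenth_half ? ?; apply: psi_inj; rewrite inE. Qed.

(** * Reduction to maps into the last axis *)

Definition on_axis (gamma : R -> R) (y : V) : V := (0, 0, gamma y.2).

Lemma on_axis_box gamma y : `|gamma y.2| < 2^-1 -> box 2^-1 (on_axis gamma y).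
Proof. by move=> ?; split=> //=; rewrite normr0; lra. Qed.

Definition axis (A : set R) : set V := [set y | y.1 = 0 /\ A y.2].

Lemma compact_axis A : compact A -> compact (axis A).
Proof.
move=> cA; rewrite (_ : axis A = [set 0] `*` A) //.
by apply: compact_setX => //; exact: compact_set1.
Qed.

Lemma on_axis_fixed gamma y :
  on_axis gamma y = y <-> y.1 = 0 /\ gamma y.2 = y.2.
Proof.
by case: y => [y1 c]; rewrite /on_axis /=; split=> [[<- ->]|[-> ->]].
Qed.

Lemma continuous_on_axis gamma : continuous gamma -> continuous (on_axis gamma).
Proof.
move=> cg y; apply: (@cvg_pair _ _ _ (nbhs y) (nbhs (0 : W * W)) (nbhs (gamma y.2))).
  exact: cvg_cst.
by apply: continuous_comp; [exact: cvg_snd|exact: cg].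
Qed.

Section Strip.
Variable J : set R.
Hypothesis openJ : open J.

Definition strip : set V := U `&` [set y | J y.2].

Lemma open_strip : open strip.
Proof.
apply: openI; first exact: open_box.
by apply: (@open_comp _ _ (@snd _ R) J) => // y _; exact: cvg_snd.
Qed.

Lemma axis_strip A : A `<=` J -> A `<=` [set c | `|c| < 10^-1] ->
  axis A `<=` strip.
Proof.
move=> AJ A10 [[u v] c] [/= [-> ->] Ac]; split; last exact: AJ.
by split=> /=; rewrite ?normr0; [lra|lra|exact: A10].
Qed.

(** Fixed points of a map into the axis lie on the axis, so only the real homotopy [eta] matters. *)
Lemma index_homotopy_on_axis (eta : R * R -> R) (A : set R) f g :
  continuous eta -> compact A -> A `<=` J -> A `<=` [set c | `|c| < 10^-1] ->
  (forall c t, J c -> `|c| < 10^-1 -> 0 <= t <= 1 ->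
     `|eta (c, t)| < 2^-1 /\ (eta (c, t) = c -> A c)) ->
  represents psi strip f (on_axis (fun c => eta (c, 0))) ->
  represents psi strip g (on_axis (fun c => eta (c, 1))) ->
  ind f (psi @` strip) = ind g (psi @` strip).
Proof.
move=> ceta cA AJ A10 fixA rf rg.
pose h (z : V * R) : V := (0, 0, eta (z.1.2, z.2)).
apply: (@index_homotopy_in_chart R X ind V psi psi_continuous psi_open strip h
  f g (axis A) open_strip _ (compact_axis cA) (axis_strip AJ A10)) => //.
- move=> z; apply: (@cvg_pair _ _ _ (nbhs z) (nbhs (0 : W * W))
     (nbhs (eta (z.1.2, z.2)))); first exact: cvg_cst.
  apply: (@continuous_comp _ _ _ (fun z : V * R => (z.1.2, z.2)) eta).
    apply: (@cvg_pair _ _ _ (nbhs z) (nbhs z.1.2) (nbhs z.2)).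
      by apply: continuous_comp; [exact: cvg_fst|exact: cvg_snd].
    exact: cvg_snd.
  exact: ceta.
- by move=> x y; rewrite !inE => -[? _] [? _]; apply: psi_injU; rewrite inE.
move=> y t [Uy Jy] t01; have [_ _ y2] := Uy.
have [e2 eA] := fixA _ _ Jy y2 t01.
move=> /(psi_fixed Uy (on_axis_box (gamma := fun c => eta (c, t)) e2)) hy.
by split=> //; move/on_axis_fixed: hy => [y1 /eA Ay].
Qed.

Lemma admissible_on_axis gamma (A : set R) f :
  continuous gamma -> compact A -> A `<=` J -> A `<=` [set c | `|c| < 10^-1] ->
  (forall c, J c -> `|c| < 10^-1 ->
     `|gamma c| < 2^-1 /\ (gamma c = c <-> A c)) ->
  represents psi strip f (on_axis gamma) ->
  admissible f (psi @` strip).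
Proof.
move=> cg cA AJ A10 fixA rf.
apply: (admissible_in_chart psi_continuous psi_open open_strip
  (continuous_on_axis cg) rf (compact_axis cA) (axis_strip AJ A10)).
move=> y [Uy Jy]; have [_ _ y2] := Uy; have [g2 gA] := fixA _ Jy y2; split.
  by move=> /(psi_fixed Uy (on_axis_box g2))/on_axis_fixed[y1 /gA].
by move=> [y1 /gA gy]; congr psi; apply/on_axis_fixed.
Qed.

End Strip.

Lemma strip0 : strip set0 = set0.
Proof. by rewrite /strip setI0. Qed.

Lemma on_axis_fixed_image J gamma (A : set R) f :
  (forall c, J c -> `|c| < 10^-1 ->
     `|gamma c| < 2^-1 /\ (gamma c = c <-> A c)) ->
  represents psi (strip J) f (on_axis gamma) ->
  [set x | (psi @` strip J) x /\ f x = x] `<=` psi @` axis A.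
Proof.
move=> fixA rf _ [[y [Uy Jy] <-]]; rewrite rf; last by split.
have [_ _ y2] := Uy; have [g2 gA] := fixA _ Jy y2.
move=> /(psi_fixed Uy (on_axis_box g2))/on_axis_fixed[y1 /gA Ay].
by exists y => //; split.
Qed.

Lemma index_excision_on_axis J J' gamma (A : set R) f :
  open J -> open J' -> J' `<=` J ->
  continuous gamma -> compact A -> A `<=` J' -> A `<=` [set c | `|c| < 10^-1] ->
  (forall c, J c -> `|c| < 10^-1 ->
     `|gamma c| < 2^-1 /\ (gamma c = c <-> A c)) ->
  represents psi (strip J) f (on_axis gamma) ->
  ind f (psi @` strip J) = ind f (psi @` strip J').
Proof.
move=> oJ oJ' J'J cg cA AJ' A10 fixA rf; apply: index_excision.
- exact: (admissible_on_axis oJ cg cA (subset_trans AJ' J'J) A10 fixA rf).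
- by apply: psi_open; exact: open_strip.
- by apply: image_subset => y [Uy J'y]; split=> //; exact: J'J.
- apply: subset_trans (on_axis_fixed_image fixA rf) _.
  by apply: image_subset; exact: axis_strip.
Qed.

Lemma stripT : strip setT = U.
Proof. by rewrite /strip setIT. Qed.

(** * Removing the two vector directions by a rotation *)

Definition dilation (y : V) : V := (2 *: y.1.1, 2 *: y.1.2, 4 * y.2).

(** On [u + iv] this is multiplication by [1 - (a + ib)], where [a + ib] follows a path from -1 to 1
    that avoids 0. The factor goes from 2 to 0 without ever being 1. *)
Definition rotation (z : V * R) : V :=
  let a := 2 * z.2 - 1 in let b := 1 - a ^+ 2 in
  ((1 - a) *: z.1.1.1 + b *: z.1.1.2, (1 - a) *: z.1.1.2 - b *: z.1.1.1,
   4 * z.1.2).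

Lemma rotation0 y : rotation (y, 0) = dilation y.
Proof.
rewrite /rotation /dilation /= mulr0 sub0r sqrrN expr1n subrr !scale0r addr0 subr0.
by rewrite opprK.
Qed.

Lemma rotation1 y : rotation (y, 1) = on_axis ( *%R 4) y.
Proof.
have e : (2 * 1 - 1 : R) = 1 by ring.
by rewrite /rotation /on_axis /= e expr1n subrr !scale0r addr0 subr0.
Qed.

Lemma continuous_rotation : continuous rotation.
Proof.
move=> z.
have c0 : y.1 @[y --> z] --> z.1 by exact: cvg_fst.
have c01 : y.1.1 @[y --> z] --> z.1.1 by exact: (cvg_comp _ _ c0 cvg_fst).
have c1 : y.1.1.1 @[y --> z] --> z.1.1.1 by exact: (cvg_comp _ _ c01 cvg_fst).
have c2 : y.1.1.2 @[y --> z] --> z.1.1.2 by exact: (cvg_comp _ _ c01 cvg_snd).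
have c3 : y.1.2 @[y --> z] --> z.1.2 by exact: (cvg_comp _ _ c0 cvg_snd).
have c4 : y.2 @[y --> z] --> z.2 by exact: cvg_snd.
have ca : 2 * y.2 - 1 @[y --> z] --> 2 * z.2 - 1.
  by apply: cvgB; [apply: cvgM => //; exact: cvg_cst|exact: cvg_cst].
have cb : 1 - (2 * y.2 - 1) ^+ 2 @[y --> z] --> 1 - (2 * z.2 - 1) ^+ 2.
  by apply: cvgB; [exact: cvg_cst|apply: cvgM].
have ca' : 1 - (2 * y.2 - 1) @[y --> z] --> 1 - (2 * z.2 - 1).
  by apply: cvgB => //; exact: cvg_cst.
apply: (@cvg_pair _ _ _ (nbhs z) (nbhs (rotation z).1) (nbhs (rotation z).2)).
  apply: (@cvg_pair _ _ _ (nbhs z) (nbhs (rotation z).1.1) (nbhs (rotation z).1.2)).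
    by apply: cvgD; apply: cvgZ.
  by apply: cvgB; apply: cvgZ.
by apply: cvgM => //; exact: cvg_cst.
Qed.

Lemma continuous_dilation : continuous dilation.
Proof.
move=> y; rewrite (_ : dilation = fun y => rotation (y, 0)); last first.
  by apply/funext => z; rewrite rotation0.
apply: (@continuous_comp _ _ _ (fun y : V => (y, 0 : R)) rotation).
  apply: (@cvg_pair _ _ _ (nbhs y) (nbhs y) (nbhs (0 : R))) => //.
  exact: cvg_cst.
exact: continuous_rotation.
Qed.

Lemma rotation_box y t : U y -> 0 <= t <= 1 -> box 2^-1 (rotation (y, t)).
Proof.
move=> [y1 y2 y3] t01; rewrite /rotation /=.
set a := 2 * t - 1; have a1 : -1 <= a <= 1 by rewrite /a; lra.
set b := 1 - a ^+ 2; have b1 : 0 <= b <= 1 by rewrite /b; nra.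
have bound (u v : W) : `|u| < 10^-1 -> `|v| < 10^-1 ->
    `|(1 - a) *: u| + `|b *: v| < 2^-1.
  move=> u1 v1; rewrite !normrZ !ger0_norm; try lra.
  have := normr_ge0 u; have := normr_ge0 v; nra.
split=> /=.
- by apply: le_lt_trans (ler_normD _ _) _; exact: bound.
- by apply: le_lt_trans (ler_normB _ _) _; exact: bound.
- by rewrite normrM ger0_norm //; lra.
Qed.

(** The equations say [(a + ib)(u + iv) = 0], and [a], [b] do not vanish together; on the last
    coordinate, [4c = c]. *)
Lemma rotation_fixed y t : rotation (y, t) = y -> y = 0.
Proof.
case: y => [[u v] c]; rewrite /rotation /=.
set a := 2 * t - 1; set b := 1 - a ^+ 2; move=> [eu ev ec].
have ab : a ^+ 2 + b ^+ 2 != 0.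
  by rewrite gt_eqF // /b; have [->|a0] := eqVneq a 0; nra.
have au : a *: u = b *: v.
  apply/esym/eqP; rewrite -subr_eq0; apply/eqP.
  by move/eqP: eu; rewrite scalerBl scale1r -addrA addrC -subr_eq0 addrK addrC => /eqP.
have av : a *: v = - (b *: u).
  apply/eqP; rewrite -subr_eq0 opprK -oppr_eq0 opprD; apply/eqP.
  by move/eqP: ev; rewrite scalerBl scale1r -addrA addrC -subr_eq0 addrK => /eqP.
have u0 : u = 0.
  apply/eqP; have /eqP : (a ^+ 2 + b ^+ 2) *: u = 0.
    by rewrite scalerDl !expr2 -!scalerA au -[b *: u]opprK -av scalerN !scalerA
      mulrC subrr.
  by rewrite scaler_eq0 (negbTE ab).
have v0 : v = 0.
  apply/eqP; have /eqP : (a ^+ 2 + b ^+ 2) *: v = 0.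
    by rewrite scalerDl !expr2 -!scalerA -au av scalerN !scalerA mulrC addNr.
  by rewrite scaler_eq0 (negbTE ab).
by rewrite u0 v0; have -> : c = 0 by lra.
Qed.

Lemma dilation_box y : U y -> box 2^-1 (dilation y).
Proof. by move=> Uy; rewrite -rotation0; apply: rotation_box => //; rewrite lexx ler01. Qed.

Lemma dilation_fixed y : dilation y = y -> y = 0.
Proof. by rewrite -rotation0; exact: rotation_fixed. Qed.

(* The fold [c |-> c ^ 2 + c + c / 20] has an expanding fixed point at [0] and a
   contracting one at [- 1 / 20]; adding a positive constant cancels them. *)
Definition fold (c s : R) : R := c * c + c + c / 20 + s.

Let fold_bound c s : `|c| < 10^-1 -> 0 <= s <= 800^-1 -> `|fold c s| < 2^-1.
Proof. by rewrite /fold !ltr_norml => /andP[c1 c2] s1; apply/andP; split; nra. Qed.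

(** The cut at [-1/40] is the midpoint of the two fixed points [-1/20] and [0] of [fold^~ 0]. *)
Let open_right : open [set c : R | - (40^-1) < c].
Proof. exact: open_gt. Qed.

Let open_left : open [set c : R | c < - (40^-1)].
Proof. exact: open_lt. Qed.

Let sub10 (A : set R) : A `<=` [set c | c = 0 \/ c = - (20^-1)] ->
  A `<=` [set c | `|c| < 10^-1].
Proof. by move=> Asub c /Asub /= [->|->]; rewrite ?normrN ger0_norm; lra. Qed.

Local Ltac continuity := 
  let z := fresh in move=> z; rewrite /fold;
  repeat first [exact: cvg_fst | exact: cvg_snd | exact: cvg_cst | exact: cvg_id
    | apply: cvgD | apply: cvgN | apply: cvgM].

(** Right of the cut, the segment from [4c] to the fold has displacement
    [c * ((1 - t) * 3 + t * (c + 1/20))]. The second factor is positive there, so [0] remains the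
    only fixed point. *)
Lemma index_quadruple_fold f g :
  represents psi U f (on_axis ( *%R 4)) -> represents psi U g (on_axis (fold^~ 0)) ->
  ind f (psi @` U) = ind g (psi @` strip [set c : R | - (40^-1) < c]).
Proof.
move=> rf rg; rewrite -stripT.
transitivity (ind f (psi @` strip [set c : R | - (40^-1) < c])).
  apply: (@index_excision_on_axis _ _ ( *%R 4) [set 0]) => //.
  - exact: openT.
  - exact: mulrl_continuous.
  - exact: compact_set1.
  - by move=> _ ->; rewrite /=; lra.
  - by apply: sub10 => _ ->; left.
  - move=> c _ c10; split; last by split=> [/= ?|->]; [lra|rewrite mulr0].
    by rewrite normrM ger0_norm //; lra.
  - by rewrite stripT.
apply: (@index_homotopy_on_axis _ open_right
  (fun z => (1 - z.2) * (4 * z.1) + z.2 * fold z.1 0) [set 0]) => //.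
- by continuity.
- exact: compact_set1.
- by move=> _ ->; rewrite /=; lra.
- by apply: sub10 => _ ->; left.
- move=> c t /= cr c10 t01; split.
    have := @fold_bound c 0 c10; move: c10; rewrite !ltr_norml.
    move=> c10 /(_ ltac:(lra)) c2; apply/andP; split; nra.
  move=> e; have /eqP : c * ((1 - t) * 3 + t * (c + 20^-1)) = 0.
    by move: e; rewrite /fold; lra.
  by rewrite mulf_eq0 => /orP[/eqP //|/eqP]; nra.
- move=> y [Uy _]; rewrite rf //; congr psi; rewrite /on_axis; congr (_, _) => /=.
  by ring.
- move=> y [Uy _]; rewrite rg //; congr psi; rewrite /on_axis; congr (_, _) => /=.
  by ring.
Qed.

(** A fixed point satisfies [c * (c + 1/20) = -s]. For [s >= 0] it lies in [[-1/20, 0]], well inside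
    [U]; at [s = 1/800] the discriminant [1/400 - 4s] is negative and no fixed point is left. *)
Lemma index_fold0 f g :
  represents psi U f (on_axis (fold^~ 0)) ->
  represents psi U g (on_axis (fold^~ 800^-1)) -> ind f (psi @` U) = 0.
Proof.
move=> rf rg; rewrite -stripT.
rewrite (@index_homotopy_on_axis setT openT (fun z => fold z.1 (z.2 / 800))
   `[- (20^-1), 0] f g) //.
- rewrite (@index_excision_on_axis setT set0 (fold^~ 800^-1) set0) ?strip0
    ?image_set0 ?index_set0 //.
  + exact: openT.
  + by continuity.
  + exact: compact0.
  + by move=> c _ c10; split; [apply: fold_bound => //; lra|rewrite /fold; split=> //; nra].
  + by rewrite stripT.
- by continuity.
- exact: segment_compact.
- by move=> c /=; rewrite in_itv /= ltr_norml; lra.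
- move=> c t _ c10 /= t01; split; first by apply: fold_bound => //; lra.
  by rewrite in_itv /= /fold; nra.
- by move=> y [Uy _]; rewrite rf //= mul0r.
- by move=> y [Uy _]; rewrite rg //= mul1r.
Qed.

(** Left of the cut, the segment from the fold to the constant [-1/20] has displacement
    [(c + 1/20) * ((1 - t) * c - t)]. The second factor is negative, so the fixed point never
    moves. *)
Lemma index_fold_left f :
  represents psi U f (on_axis (fold^~ 0)) ->
  ind f (psi @` strip [set c : R | c < - (40^-1)]) = 1.
Proof.
move=> rf.
rewrite (@index_homotopy_on_axis _ open_left
  (fun z => (1 - z.2) * fold z.1 0 - z.2 / 20) [set - (20^-1)] f
  (fun=> psi (0, 0, - (20^-1)))) //.
- rewrite index_cst //; first by apply: psi_open; exact: open_strip.
  exists (0, 0, - (20^-1)) => //; split; last by rewrite /=; lra.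
  by split; rewrite /= ?normr0 ?normrN ?ger0_norm //; lra.
- by continuity.
- exact: compact_set1.
- by move=> _ ->; rewrite /=; lra.
- by apply: sub10 => _ ->; right.
- move=> c t /= cl c10 t01; split.
    have := @fold_bound c 0 c10; move: c10; rewrite !ltr_norml.
    move=> c10 /(_ ltac:(lra)) c2; apply/andP; split; nra.
  move=> e; have /eqP : (c + 20^-1) * ((1 - t) * c - t) = 0.
    by move: e; rewrite /fold; lra.
  by rewrite mulf_eq0 => /orP[/eqP ?|/eqP ?]; [lra|nra].
- by move=> y [Uy _]; rewrite rf //; congr psi; rewrite /on_axis; congr (_, _) => /=; ring.
- by move=> y [Uy _]; congr psi; rewrite /on_axis; congr (_, _) => /=; ring.
Qed.

Lemma index_fold_split f :
  represents psi U f (on_axis (fold^~ 0)) ->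
  ind f (psi @` U) = ind f (psi @` strip [set c : R | - (40^-1) < c]) +
                     ind f (psi @` strip [set c : R | c < - (40^-1)]).
Proof.
move=> rf; rewrite -stripT.
have fixE c : setT c -> `|c| < 10^-1 ->
    `|fold c 0| < 2^-1 /\ (fold c 0 = c <-> ([set 0] `|` [set - (20^-1)]) c).
  move=> _ c10; split; first by apply: fold_bound => //; lra.
  split=> [e|[->|->]]; rewrite /fold; try lra.
  have /eqP : c * (c + 20^-1) = 0 by move: e; rewrite /fold; lra.
  by rewrite mulf_eq0 => /orP[/eqP ?|/eqP ?]; [left|right=> /=; lra].
have rfT : represents psi (strip setT) f (on_axis (fold^~ 0)) by rewrite stripT.
have sub : [set 0] `|` [set - (20^-1)] `<=` [set c : R | `|c| < 10^-1].
  by apply: sub10 => c [->|->]; [left|right].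
apply: index_additivity.
- apply: (admissible_on_axis openT _ _ _ sub fixE rfT) => //.
    by continuity.
  by apply: compactU; exact: compact_set1.
- by apply: psi_open; exact: open_strip.
- by apply: psi_open; exact: open_strip.
- by apply: image_subset => y [Uy _].
- by apply: image_subset => y [Uy _].
- rewrite -subset0 => _ [[y [Uy yr] <-] [z [Uz zl] /psi_injU e]].
  by move: zl; rewrite e ?inE // /mkset; move: yr; rewrite /mkset; lra.
- apply: subset_trans (on_axis_fixed_image fixE rfT) _.
  move=> _ [y yA <-]; have [Uy _] := axis_strip (@subsetT _ _) sub yA.
  case: yA => _ [e|e]; [left|right]; exists y => //; split=> //=; rewrite e /=; lra.
Qed.

Lemma index_dilation f : represents psi U f dilation -> ind f (psi @` U) = -1.
Proof.
move=> rf.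
(* The auxiliary maps matter only on the image of [U], so any extension to [X] will do. *)
have exrep phi : exists g, represents psi U g phi.
  by exists (psi \o phi \o chart_inv psi U); exact: represents_chart_inv.
have [f1 rf1] := exrep (on_axis ( *%R 4)).
have [g0 rg0] := exrep (on_axis (fold^~ 0)).
have [g1 rg1] := exrep (on_axis (fold^~ (800^-1))).
have -> : ind f (psi @` U) = ind f1 (psi @` U).
  have sub0 : [set 0 : V] `<=` U by move=> _ ->; split=> /=; rewrite normr0; lra.
  refine (index_homotopy_in_chart ind psi_continuous psi_open (@open_box 10^-1)
    continuous_rotation (@compact_set1 _ _) sub0 psi_injU _ _ _).
  - move=> y t Uy t01 /(psi_fixed Uy (rotation_box Uy t01)) hy.
    by split=> //; exact: rotation_fixed hy.
  - by move=> y Uy; rewrite rotation0; exact: rf.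
  - by move=> y Uy; rewrite rotation1 rf1.
rewrite (index_quadruple_fold rf1 rg0).
(* The total index 0 of the fold is its index at [0] plus the index 1 at [-1/20]. *)
have := index_fold_split rg0; rewrite (index_fold0 rg0 rg1) (index_fold_left rg0).
lia.
Qed.

End LocalIndex.

(** * The Reidemeister trace of the nilmanifold dilation *)

Section DilationTrace.
Variables (R : realType) (r : nat).
Local Notation V := ('rV[R]_r * 'rV[R]_r * R)%type.

Definition translation (x : heis R r) (y : V) : V := (x * (y : heis R r))%g.

Lemma translation_continuous x : continuous (translation x).
Proof.
case: x => [[u v] c] y.
have c1 : z.1 @[z --> y] --> y.1 by exact: cvg_fst.
have c2 : z.2 @[z --> y] --> y.2 by exact: cvg_snd.
have cu : z.1.1 @[z --> y] --> y.1.1 by exact: (cvg_comp _ _ c1 cvg_fst).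
have cv : z.1.2 @[z --> y] --> y.1.2 by exact: (cvg_comp _ _ c1 cvg_snd).
rewrite [X in continuous_at _ X](_ : _ =
    fun z : V => (u + z.1.1, v + z.1.2, c + z.2 - dot z.1.1 v)); last first.
  by apply/funext => -[[]].
apply: (@cvg_pair _ _ _ (nbhs y) (nbhs (u + y.1.1, v + y.1.2))
  (nbhs (c + y.2 - dot y.1.1 v))).
  apply: (@cvg_pair _ _ _ (nbhs y) (nbhs (u + y.1.1)) (nbhs (v + y.1.2))).
    by apply: cvgD => //; exact: cvg_cst.
  by apply: cvgD => //; exact: cvg_cst.
apply: cvgB; first by apply: cvgD => //; exact: cvg_cst.
rewrite /dot; apply: cvg_big => [|i _]; first exact: add_continuous.
apply: cvgM; last exact: cvg_cst.
exact: (cvg_comp _ _ cu (@coord_continuous _ _ _ 0 i _)).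
Qed.

Lemma translation_open x (A : set V) : open A -> open (translation x @` A).
Proof.
move=> oA; rewrite (_ : _ @` A = translation x^-1%g @^-1` A); last first.
  apply/seteqP; split=> [_ [y Ay <-]|y Ay].
    by rewrite /translation /= mulKg.
  by exists (translation x^-1%g y) => //; rewrite /translation mulVKg.
by apply: open_comp => // y _; exact: translation_continuous.
Qed.

Lemma nil_proj_continuous : continuous (@nil_proj R r : V -> nilmanifold R r).
Proof. exact: pi_continuous. Qed.

Lemma nil_proj_open (A : set V) : open A -> open (@nil_proj R r @` A).
Proof.
move=> oA; have -> : open (@nil_proj R r @` A) =
  open ((@nil_proj R r : V -> _) @^-1` (@nil_proj R r @` A)) by [].
(* The saturation of [A] is the union of its lattice translates. *)
rewrite (_ : _ @^-1` _ = \bigcup_(g : heis int r) (translation (heis_incl R g) @` A)).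
  by apply: bigcup_open => g _; exact: translation_open.
apply/seteqP; split=> [y [x Ax /nil_projP[g ->]]|y [g _ [x Ax <-]]].
  by exists g => //; exists x.
by exists x => //; apply/nil_projP; exists g.
Qed.

(** * Charts of the nilmanifold *)

Definition nil_chart (x : heis R r) (y : V) : nilmanifold R r :=
  nil_proj (translation x y).

Lemma nil_chart0 x : nil_chart x 0 = nil_proj x.
Proof. by rewrite /nil_chart /translation mulg1. Qed.

Lemma nil_chart_continuous x : continuous (nil_chart x).
Proof.
move=> y; apply: (@continuous_comp _ _ _ (translation x) (@nil_proj R r)).
  exact: translation_continuous.
exact: nil_proj_continuous.
Qed.

Lemma nil_chart_open x (A : set V) : open A -> open (nil_chart x @` A).
Proof.
move=> oA; rewrite (_ : _ @` A = @nil_proj R r @` (translation x @` A)).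
  by apply: nil_proj_open; exact: translation_open.
by rewrite image_comp.
Qed.

Lemma intr_small (n : int) : `|n%:~R : R| < 1 -> n = 0.
Proof. by rewrite -intr_norm ltrz1 => ?; lia. Qed.

Lemma intr_mx_small (p : 'rV[int]_r) (u u' : 'rV[R]_r) :
  `|u| < 2^-1 -> `|u'| < 2^-1 -> u' = map_mx intr p + u -> p = 0.
Proof.
move=> u2 u2' e; apply/rowP => i; rewrite mxE; apply: intr_small.
have coord (w : 'rV[R]_r) : `|w| < 2^-1 -> `|w 0 i| < 2^-1.
  apply: le_lt_trans.
  by rewrite /Num.norm /= mx_normrE; apply: (le_bigmax _ _ (0, i)).
move: (coord _ u2) (coord _ u2'); rewrite e !mxE !ltr_norml; lra.
Qed.

(** Two points of the box differ by less than 1 in each coordinate, so the integer vectors [p] and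
    [q] of the lattice element vanish first. This removes the dot products from the last coordinate,
    and the integer [s] vanishes in turn. *)
Lemma nil_chart_inj x : set_inj (box 2^-1) (nil_chart x).
Proof.
move=> y y'; rewrite !inE => -[u2 v2 c2] [u2' v2' c2'].
case/nil_projP=> g; rewrite /translation /lattice_act.
case: x g y y' u2 v2 c2 u2' v2' c2' => [[a b] d] [[p q] s] [[u v] c] [[u' v'] c'].
rewrite /= => u2 v2 c2 u2' v2' c2'.
rewrite -![(_ * _)%g]/(heis_mul _ _) /= => -[eu ev ec].
have p0 : p = 0.
  apply: (intr_mx_small u2 u2'); apply: (addrI a).
  by rewrite eu !addrA [a + _]addrC.
have q0 : q = 0.
  apply: (intr_mx_small v2 v2'); apply: (addrI b).
  by rewrite ev !addrA [b + _]addrC.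
move: eu ev ec; rewrite p0 q0 !map_mx0 !add0r => /addrI eu /addrI ev.
rewrite eu ev dot0r subr0 => ec.
have ecs : c' = s%:~R + c by lra.
have s0 : s = 0.
  by apply: intr_small; move: c2 c2'; rewrite ecs !ltr_norml; lra.
by rewrite ecs s0 add0r.
Qed.

(** * The induced map and its fixed points *)

Lemma nil_dilation_continuous : continuous (@nil_dilation R r).
Proof.
apply/quotient_continuous => y.
rewrite (_ : _ \o _ = @nil_proj R r \o (@dilation R 'rV[R]_r)); last first.
  by apply/funext => -[[u v] c]; exact: nil_dilationE.
apply: continuous_comp; [exact: continuous_dilation|exact: nil_proj_continuous].
Qed.

(** The solution of [p + 2u = u], [q + 2v = v], [s + 4c - 2u.q = c]. *)
Definition dilation_fixed_point (a : heis int r) : heis R r :=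
  let: (p, q, s) := a in
  (- map_mx intr p, - map_mx intr q, - (s%:~R + 2 * (dot p q)%:~R) / 3).

Lemma dilation_fixed_pointP a x :
  lattice_act a (heis_dilation x) = x <-> x = dilation_fixed_point a.
Proof.
case: a x => [[p q] s] [[u v] c].
rewrite /lattice_act -![(_ * _)%g]/(heis_mul _ _) /=.
have eqN (w z : 'rV[R]_r) : z + 2 *: w = w <-> w = - z.
  rewrite scaler_nat mulr2n addrA; split=> [/(congr1 (fun t => t - w))|->].
    by rewrite addrK subrr => /eqP; rewrite addr_eq0 => /eqP ->; rewrite opprK.
  by rewrite subrr add0r.
split=> [[/eqN -> /eqN -> ec]|[-> -> ->]].
  congr (_, _, _); move: ec; rewrite dotZl dotNl dot_intr; lra.
by congr (_, _, _); [exact/eqN|exact/eqN|rewrite dotZl dotNl dot_intr; lra].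
Qed.

(** With [x = a D(x)] and [D] multiplicative, [a D(xy) = x D(y)]. *)
Lemma nil_chart_dilation a y :
  nil_dilation (nil_chart (dilation_fixed_point a) y) =
  nil_chart (dilation_fixed_point a) (dilation y).
Proof.
set x := dilation_fixed_point a.
have xE : lattice_act a (heis_dilation x) = x by apply/dilation_fixed_pointP.
rewrite /nil_chart nil_dilationE; apply/nil_projP; exists a.
rewrite /translation heis_dilation_multiplicative.
rewrite -[X in (X * _)%g = _]xE /lattice_act -mulgA; congr (_ * (_ * _))%g.
by case: y => -[].
Qed.

Lemma fixed_point_classE a :
  fixed_point_class (@nil_proj R r) (@lattice_act R r) (@heis_dilation R r) a =
  [set nil_proj (dilation_fixed_point a)].
Proof.
rewrite /fixed_point_class (_ : mkset _ = [set dilation_fixed_point a]).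
  by rewrite image_set1.
by apply/seteqP; split=> x /= /dilation_fixed_pointP.
Qed.

(** Each fixed-point class is a single point, isolated by the chart centred at it, so its index is
    that of the linear dilation at the origin. *)
Lemma dilation_traceE (ind : fixed_point_index R (nilmanifold R r)) x :
  dilation_trace ind x = -1.
Proof.
rewrite /dilation_trace /reidemeister_trace fixed_point_classE.
set a := reidemeister_repr x; set x0 := dilation_fixed_point a.
have rep : represents (nil_chart x0) (box 10^-1) (@nil_dilation R r) (@dilation R _).
  by move=> y _; exact: nil_chart_dilation.
rewrite -(index_dilation ind (@nil_chart_continuous x0) (@nil_chart_open x0)
  (@nil_chart_inj x0) rep).
apply: isolated_indexE.
- by apply: nil_chart_open; exact: open_box.
- exact: nil_dilation_continuous.
- exact: compact_set1.
apply/seteqP; split=> [_ [[y Uy <-]]|_ ->].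
  rewrite rep // => e; have Dy : dilation y = y.
    by apply: (psi_fixed (@nil_chart_inj x0) Uy _ e); exact: dilation_box.
  by rewrite (dilation_fixed Dy) nil_chart0.
have U0 : box 10^-1 (0 : V) by split; rewrite normr0; lra.
rewrite -nil_chart0; split; first by exists 0.
by rewrite rep // /dilation !scaler0 mulr0.
Qed.

End DilationTrace.

(** * Cardinals, extrema and pushforwards *)

Section Extrema.

Lemma max_natE (S : set nat) m : S m -> (forall n, S n -> (n <= m)%N) -> max_nat S = m.
Proof.
move=> Sm le_m; rewrite /max_nat; case: xgetP => [k _ [Sk le_k]|/(_ m)/= []//].
by apply/eqP; rewrite eqn_leq le_m // le_k.
Qed.

Lemma min_natE (S : set nat) m :
  S m -> (forall n, S n -> (m <= n)%N) -> min_nat S = Some m.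
Proof.
move=> Sm m_le; rewrite /min_nat; case: pselect => [? /=|[]]; last by exists m.
congr Some; case: xgetP => [k _ [Sk k_le]|none]; last by case: (none m).
by apply/eqP; rewrite eqn_leq k_le // m_le.
Qed.

End Extrema.

Lemma norm1E (K : choiceType) (t : K -> int) : finite_set [set: K] ->
  norm1 t = (\sum_(a <- fset_set [set: K]) `|t a|)%N.
Proof. by move=> fK; rewrite /norm1 fsbig_finite. Qed.

Section Cardinal.
Variables (K L : choiceType).
Implicit Types (t : K -> int) (h : K -> L) (A : set K).

Lemma card_fset_set_image h A :
  finite_set A -> (#|` fset_set (h @` A)| <= #|` fset_set A|)%N.
Proof. by move=> fA; rewrite fset_set_image // leq_imfset_card. Qed.

Lemma card_fset_set_image_inj h A : finite_set A -> set_inj A h ->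
  #|` fset_set (h @` A)| = #|` fset_set A|.
Proof.
move=> fA inj; rewrite fset_set_image // card_in_imfset //.
by move=> x y; rewrite /= !in_fset_set //; exact: inj.
Qed.

Lemma absz_sum_nonpos (I : Type) (s : seq I) (F : I -> int) :
  (forall i, F i <= 0) -> absz (\sum_(i <- s) F i) = (\sum_(i <- s) `|F i|)%N.
Proof.
move=> F0; suff [_ ->] : \sum_(i <- s) F i <= 0 /\
  absz (\sum_(i <- s) F i) = (\sum_(i <- s) `|F i|)%N by [].
elim: s => [|i s [s0 IHs]]; first by rewrite !big_nil.
have Fi := F0 i; rewrite !big_cons -IHs; move: (\sum_(j <- s) F j) s0 => x x0; split; lia.
Qed.

Lemma finite_preimageT h b : finite_set [set: K] -> finite_set (h @^-1` [set b]).
Proof. by move=> fK; exact: sub_finite_set fK. Qed.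

(** All coefficients have the same sign, so nothing cancels inside a fibre of [h]. *)
Lemma norm1_pushforward_nonpos t h :
  finite_set [set: K] -> finite_set [set: L] -> (forall a, t a <= 0) ->
  norm1 (Defs.pushforward h t) = norm1 t.
Proof.
move=> fK fL t0; rewrite norm1E; last exact: fL.
transitivity (\sum_(b <- fset_set [set: L])
    \sum_(a <- fset_set [set: K] | h a == b) `|t a|)%N.
  apply: eq_bigr => b _; rewrite /Defs.pushforward fsbig_mkcond fsbig_finite //.
  rewrite absz_sum_nonpos; last by move=> a; rewrite /patch; case: ifP.
  rewrite [RHS]big_mkcond; apply: eq_bigr => a _.
  by rewrite /patch; case: eqP => hab; [rewrite mem_set|rewrite memNset].
rewrite (exchange_big_dep xpredT) //= norm1E //; apply: eq_bigr => a _.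
rewrite big_mkcond (bigD1_seq (h a)) ?fset_uniq ?in_fset_set ?inE //= eqxx.
by rewrite big1 ?addn0 // => b; rewrite eq_sym => /negbTE ->.
Qed.

(** Negative coefficients cannot sum to zero over a nonempty fibre. *)
Lemma supp_pushforward_neg t h : finite_set [set: K] -> (forall a, t a < 0) ->
  supp (Defs.pushforward h t) = h @` [set: K].
Proof.
move=> fK t0; apply/seteqP; split=> [b /eqP|_ [a _ <-]].
  apply: contra_notP => nb; rewrite /Defs.pushforward (_ : _ @^-1` _ = set0) ?fsbig_set0 //.
  by apply/seteqP; split=> // a /= hab; case: nb; exists a.
rewrite /supp /= /Defs.pushforward (fsbigD1 a) //; last exact: finite_preimageT.
rewrite lt_eqF // ltr_wnDr //.
by apply: fsumr_le0 => *; exact: ltW.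
Qed.

End Cardinal.
Lemma card_setT_finType (T : finType) : #|` fset_set [set: T]| = #|T|.
Proof.
apply: card_fset_set.
rewrite (card_eqr card_II) -(_ : enum_val @` [set: 'I_#|T|] = [set: T]).
  by apply: inj_card_eq => x y _ _; exact: enum_val_inj.
by apply/seteqP; split=> // x _; exists (enum_rank x) => //; exact: enum_rankK.
Qed.

Lemma finite_setT_inj (K : choiceType) (T : finType) (g : K -> T) :
  injective g -> finite_set [set: K].
Proof.
move=> inj; apply: (@sub_finite_set _ _ (g @^-1` [set: T])) => //.
by apply: finite_preimage => // x y _ _; exact: inj.
Qed.

Lemma leq_card_setT_surj (K : choiceType) (T : finType) (g : K -> T) :
  finite_set [set: K] -> (forall y, exists x, g x = y) ->
  (#|T| <= #|` fset_set [set: K]|)%N.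
Proof.
move=> fK surj; rewrite -card_setT_finType.
rewrite (_ : [set: T] = g @` [set: K]); first exact: card_fset_set_image.
by apply/seteqP; split=> // y _; have [x <-] := surj y; exists x.
Qed.

Lemma card_setT_bij (K : choiceType) (T : finType) (g : K -> T) :
  injective g -> (forall y, exists x, g x = y) ->
  #|` fset_set [set: K]| = #|T|.
Proof.
move=> inj surj; rewrite -card_setT_finType.
rewrite (_ : [set: T] = g @` [set: K]).
  rewrite card_fset_set_image_inj //; first exact: finite_setT_inj inj.
  by move=> x y _ _; exact: inj.
by apply/seteqP; split=> // y _; have [x <-] := surj y; exists x.
Qed.

(** * Reduction of the integral Heisenberg group modulo 3 *)

Section HeisReduction.
Variable r : nat.
Local Notation H := (heis int r).
Local Notation H3 := (heis 'Z_3 r).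
Local Open Scope group_scope.

Definition reduction (x : H) : H3 :=
  let: (u, v, c) := x in (map_mx intr u, map_mx intr v, c%:~R)%R.

Lemma reductionM x y : reduction (x * y) = reduction x * reduction y.
Proof.
case: x y => [[u v] c] [[u' v'] c'].
rewrite -![(_ * _)%g]/(heis_mul _ _) /= !map_mxD rmorphB rmorphD; congr (_, _, _).
by congr (_ - _)%R; rewrite /dot rmorph_sum; apply: eq_bigr => i _; rewrite !mxE rmorphM.
Qed.

HB.instance Definition _ := isUMagmaMorphism.Build H H3
  reduction (group_hom_monoid reductionM).

Lemma reduction_dilation x : reduction (heis_dilation x) = heis_dilation (reduction x).
Proof.
case: x => [[u v] c] /=; rewrite /heis_dilation /=; congr (_, _, _).
- by apply/rowP => i; rewrite !mxE rmorphM.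
- by apply/rowP => i; rewrite !mxE rmorphM.
- by rewrite rmorphM.
Qed.

Lemma reduction_surj (y : H3) : exists x, reduction x = y.
Proof.
case: y => [[u v] c].
pose lift (z : 'Z_3) : int := (z : nat)%:Z.
have liftK z : ((lift z)%:~R)%R = z by rewrite /lift -pmulrn natr_Zp.
exists (map_mx lift u, map_mx lift v, lift c) => /=.
by congr (_, _, _); rewrite ?liftK //; apply/rowP => i; rewrite !mxE liftK.
Qed.

Lemma card_heis3 : #|{: 'rV['Z_3]_r * 'rV['Z_3]_r * 'Z_3}| = (3 ^ (2 * r + 1))%N.
Proof.
rewrite !card_prod !card_mx !card_ord /= mul1n -!expnD addn1 expnSr mul2n -addnn.
by [].
Qed.

(** * The invariant of twisted conjugacy *)

Definition kappa3 (x : H3) : 'Z_3 := (x.2 - dot x.1.1 x.1.2)%R.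

Lemma three_eq0 : (3%:R = 0 :> 'Z_3)%R.
Proof. exact/val_inj. Qed.

(** In any commutative ring, twisted conjugation by [(p, q, s)] lowers [s0 - p0.q0] by three times
    [s + p.q - p.q0]. *)
Lemma kappa3_twisted (g a : H3) : kappa3 (g * a * (heis_dilation g)^-1) = kappa3 a.
Proof.
case: g a => [[p q] s] [[p0 q0] s0].
rewrite -![(_ * _)%g]/(heis_mul _ _) -![(_ ^-1)%g]/(heis_inv _) /kappa3 /=.
rewrite !(dotDl, dotDr, dotNl, dotNr, dotZl, dotZr).
transitivity (s0 - dot p0 q0 - 3%:R * (s + dot p q - dot p q0))%R.
  by ring.
by rewrite three_eq0 mul0r subr0.
Qed.

(** Ordinary conjugation, in contrast, shifts the invariant by the symplectic pairing of the vector
    parts; this lets normality constrain the elements of an observer. *)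
Lemma kappa3_conj (g n : H3) :
  kappa3 (g * n * g^-1) = (kappa3 n + dot g.1.1 n.1.2 - dot n.1.1 g.1.2)%R.
Proof.
case: g n => [[p q] s] [[p0 q0] s0].
rewrite -![(_ * _)%g]/(heis_mul _ _) -![(_ ^-1)%g]/(heis_inv _) /kappa3 /=.
by rewrite !(dotDl, dotDr, dotNl, dotNr); ring.
Qed.

Definition kappa (x : H) : 'Z_3 := kappa3 (reduction x).

Lemma intr_Z3_eq0 (x : int) : (x%:~R = 0 :> 'Z_3)%R -> exists m : int, (x = 3 * m)%R.
Proof.
move=> x0; exists (x %/ 3)%Z; rewrite {1}(divz_eq x 3) mulrC.
suff -> : (x %% 3)%Z = 0%R by rewrite addr0.
have : ((x %% 3)%Z%:~R = 0 :> 'Z_3)%R.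
  have three0 : ((3 : int)%:~R = 0 :> 'Z_3)%R by exact/val_inj.
  by move: x0; rewrite {1}(divz_eq x 3) intrD intrM three0 mulr0 add0r.
have : (0 <= x %% 3 < 3)%Z by rewrite modz_ge0 // ltz_pmod.
case: (x %% 3)%Z => [[|[|[|n]]]|n] // _ /(congr1 val) //.
Qed.

Lemma twisted_conjP (a b : H) :
  twisted_conj (@heis_dilation int r) a b <-> kappa a = kappa b.
Proof.
split=> [[g ->]|].
  by rewrite /kappa !reductionM gmulfV /= reduction_dilation kappa3_twisted.
case: a b => [[p0 q0] s0] [[p1 q1] s1].
have red_dot (u v : 'rV[int]_r) :
    dot (map_mx intr u : 'rV['Z_3]_r) (map_mx intr v) = ((dot u v)%:~R)%R.
  by rewrite /dot rmorph_sum; apply: eq_bigr => i _; rewrite !mxE rmorphM.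
rewrite /kappa /kappa3 /= !red_dot -!rmorphB => /eqP.
rewrite -subr_eq0 -rmorphB => /eqP/intr_Z3_eq0[m em].
(* The vector parts solve [p + p0 - 2p = p1] and [q + q0 - 2q = q1]. The last entry solves
   [s + p.q - p.q0 = m], since twisting lowers the integral invariant by three times the left
   side. *)
exists (p0 - p1, q0 - q1, m - dot (p0 - p1) (q0 - q1) + dot (p0 - p1) q0)%R.
rewrite -![(_ * _)%g]/(heis_mul _ _) -![(_ ^-1)%g]/(heis_inv _) /=.
congr (_, _, _).
- by apply/rowP => i; rewrite !mxE; ring.
- by apply/rowP => i; rewrite !mxE; ring.
have -> : s1 = (s0 - dot p0 q0 + dot p1 q1 - 3 * m)%R by rewrite -em; ring.
by rewrite !(dotDl, dotDr, dotNl, dotNr, dotZl, dotZr); ring.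
Qed.

End HeisReduction.

(** * Observers of the Heisenberg dilation *)

Section DilationObservers.
Variable r : nat.
Local Notation H := (heis int r).
Local Notation phi := (@heis_dilation int r).
Local Notation H3 := ('rV['Z_3]_r * 'rV['Z_3]_r * 'Z_3)%type.
Implicit Type N : observer phi.

(** * The three Reidemeister classes, labelled by residues *)

Lemma dilation_class_eq (a b : H) :
  reidemeister_class phi a = reidemeister_class phi b <-> kappa a = kappa b.
Proof. by rewrite reidemeister_classP twisted_conjP. Qed.

Definition central (k : int) : H := (0, 0, k).

Lemma centralC k (x : H) : (central k * x = x * central k)%g.
Proof.
case: x => [[u v] c]; rewrite /central -![(_ * _)%g]/(heis_mul _ _) /=.
by rewrite !add0r !addr0 dot0l dot0r (addrC k).
Qed.

Lemma kappaM_central (x : H) k : kappa (x * central k)%g = kappa x + k%:~R.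
Proof.
rewrite /kappa reductionM; case: x => [[u v] c].
rewrite -![(_ * _)%g]/(heis_mul _ _) /kappa3 /= !map_mx0.
by rewrite !addr0 dot0l subr0 addrAC.
Qed.

Lemma kappa1 : kappa (1%g : H) = 0.
Proof. by rewrite /kappa gmulf1 /kappa3 -[1%g]/(heis_one _ _) /= dot0l subr0. Qed.

(** Central representatives turn addition of residues into multiplication by central elements. *)
Definition class_of_residue (w : 'Z_3) : reidemeister phi :=
  reidemeister_class phi (central (w : nat)%:Z).

Lemma class_of_residueE a : reidemeister_class phi a = class_of_residue (kappa a).
Proof.
apply/dilation_class_eq; rewrite -[central _]mul1g kappaM_central kappa1 add0r.
by rewrite -pmulrn natr_Zp.
Qed.

Lemma class_of_residue_inj : injective class_of_residue.
Proof.
move=> w w' /dilation_class_eq.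
rewrite -[central w]mul1g -[central w']mul1g !kappaM_central.
by rewrite -!pmulrn !natr_Zp => /addrI.
Qed.

Lemma class_of_residueD w d : class_of_residue (w + d) =
  reidemeister_class phi (central (w : nat)%:Z * central (d : nat)%:Z)%g.
Proof.
rewrite [RHS]class_of_residueE kappaM_central -[central w]mul1g kappaM_central.
by rewrite kappa1 add0r -!pmulrn !natr_Zp.
Qed.

Definition residue (x : reidemeister phi) : 'Z_3 := kappa (reidemeister_repr x).

Lemma residueK : cancel residue class_of_residue.
Proof. by move=> x; rewrite /residue -class_of_residueE reidemeister_reprK. Qed.

Lemma class_of_residueK : cancel class_of_residue residue.
Proof. by move=> w; apply: class_of_residue_inj; rewrite residueK. Qed.

Lemma finite_dilation_classes : finite_set [set: reidemeister phi].
Proof. exact: finite_setT_inj (can_inj residueK). Qed.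

Lemma card_dilation_classes : #|` fset_set [set: reidemeister phi]| = 3%N.
Proof.
rewrite (card_setT_bij (can_inj residueK)) ?card_ord // => w.
by exists (class_of_residue w); rewrite class_of_residueK.
Qed.

Lemma observe_surj N y : exists x, observe N x = y.
Proof.
exists (reidemeister_class phi (repr (reidemeister_repr y))).
by rewrite observeE quotient_map_repr reidemeister_reprK.
Qed.

Lemma observe_image N : observe N @` [set: _] = [set: _].
Proof. by apply/seteqP; split=> // y _; have [x <-] := observe_surj y; exists x. Qed.

(** A central element stays central in the quotient, so it moves past the twisting factor. *)
Lemma observe_central N a b k :
  observe N (reidemeister_class phi a) = observe N (reidemeister_class phi b) ->
  observe N (reidemeister_class phi (a * central k)%g) =
  observe N (reidemeister_class phi (b * central k)%g).
Proof.
rewrite !observeE => /reidemeister_classP[g eb]; apply/reidemeister_classP; exists g.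
rewrite !quotient_mapM eb -!mulgA; congr (_ * (_ * _))%g.
rewrite -(quotient_map_repr (induced_hom g)^-1%g).
by rewrite -!quotient_mapM centralC.
Qed.

(** A nonzero residue generates ['Z_3]. *)
Lemma Z3_multiples (u v e : 'Z_3) : e != 0 -> [\/ u = v, u = v + e | u = v + e + e].
Proof.
case: u v e => [[|[|[|?]]] ?] // [[|[|[|?]]] ?] // [[|[|[|?]]] ?] // _;
  first [ by constructor 1; exact/val_inj | by constructor 2; exact/val_inj
        | by constructor 3; exact/val_inj ].
Qed.

(* Translation by the centre acts transitively on the three classes and
   commutes with observation, so that two merged classes merge with the third. *)
Lemma observe_inj_or_cst N :
  injective (observe N) \/ forall x y, observe N x = observe N y.
Proof.
have [inj|ninj] := pselect (injective (observe N)); [by left|right].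
pose f w := observe N (class_of_residue w).
have fD w w' d : f w = f w' -> f (w + d) = f (w' + d).
  by move=> /(observe_central (d : nat)%:Z); rewrite -!class_of_residueD.
have [w [w' [fw ww']]] : exists w w', f w = f w' /\ w != w'.
  apply: contra_notP ninj => none x y.
  rewrite -(residueK x) -(residueK y) => fxy; congr class_of_residue.
  by apply/eqP; apply: contra_notT none => xy; exists (residue x), (residue y).
have fe v : f v = f (v + (w' - w)).
  have := fD _ _ (v - w) fw; rewrite addrCA subrr addr0 => ->; congr f; ring.
have fcst u v : f u = f v.
  have e0 : w' - w != 0 by rewrite subr_eq0 eq_sym.
  by have [->|->|->] := Z3_multiples u v e0; rewrite -?fe.
by move=> x y; rewrite -(residueK x) -(residueK y); exact: fcst.
Qed.

(** * Observing a trace whose coefficients are all -1 *)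

Section Trace.
Variable t : reidemeister phi -> int.
Hypothesis tE : forall x, t x = -1.

Lemma norm1_trace : norm1 t = 3%N.
Proof.
rewrite norm1E; last exact: finite_dilation_classes.
rewrite (eq_bigr (fun=> 1%N)); last by move=> x _; rewrite tE.
by rewrite sum1_size card_dilation_classes.
Qed.

Lemma card_supp_trace : card_supp t = 3%N.
Proof.
rewrite -card_dilation_classes /card_supp; congr (#|` fset_set _|).
by apply/seteqP; split=> // x _; rewrite /supp /= tE.
Qed.

Lemma index_mass_trace N : index_mass t N = 3%N.
Proof.
rewrite -norm1_trace; apply: norm1_pushforward_nonpos => [||x]; last by rewrite tE.
  exact: finite_dilation_classes.
by rewrite -observe_image; apply: finite_image; exact: finite_dilation_classes.
Qed.

Lemma observed_trace_neq0 N : exists b, observed_trace t (N := N) b != 0.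
Proof.
pose x0 := class_of_residue 0; exists (observe N x0).
suff : supp (observed_trace t (N := N)) (observe N x0) by [].
rewrite supp_pushforward_neg; [by exists x0|exact: finite_dilation_classes|].
by move=> x; rewrite tE.
Qed.

Lemma visibilityE N : visibility t N = #|` fset_set (observe N @` [set: _])|.
Proof.
rewrite /visibility /card_supp supp_pushforward_neg // => [|x]; last by rewrite tE.
exact: finite_dilation_classes.
Qed.

Lemma visibility_inj N : injective (observe N) -> visibility t N = 3%N.
Proof.
move=> inj; rewrite visibilityE card_fset_set_image_inj ?card_dilation_classes //.
  exact: finite_dilation_classes.
by move=> x y _ _; exact: inj.
Qed.

Lemma visibility_cst N :
  (forall x y, observe N x = observe N y) -> visibility t N = 1%N.
Proof.
move=> cst; pose x0 := class_of_residue 0.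
rewrite visibilityE (_ : _ @` _ = [set observe N x0]) ?fset_set1 ?cardfs1 //.
by apply/seteqP; split=> [_ [x _ <-]|_ ->]; [exact: cst|exists x0].
Qed.

End Trace.

(** * Index bound for separating observers *)

Lemma observe_inj_kernel N n : injective (observe N) -> N n -> reduction n = 1%g.
Proof.
move=> inj Nn.
(* An element of [N] has the same image as 1 in the quotient, hence the same observed class. *)
have kN m : N m -> kappa m = 0.
  move=> Nm; rewrite -kappa1; apply/dilation_class_eq/inj; rewrite !observeE.
  congr reidemeister_class; apply/quotient_mapP; rewrite mulg1.
  exact: normal_setV.
have conj g : dot (reduction g).1.1 (reduction n).1.2 =
              dot (reduction n).1.1 (reduction g).1.2.
  (* The conjugate of [n] by [g] also lies in [N], so the symplectic shift vanishes. *)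
  have := kN _ (normal_setJ g Nn).
  rewrite /kappa !reductionM gmulfV /= kappa3_conj -/(kappa n) kN // add0r.
  by move/subr0_eq.
have dot_deltal i (u : 'rV['Z_3]_r) : dot (delta_mx 0 i) u = u 0 i.
  rewrite /dot (bigD1 i) //= big1 ?addr0 => [|j ji]; rewrite mxE ?eqxx ?mul1r //.
  by rewrite (negbTE ji) mul0r.
have dot_deltar i (u : 'rV['Z_3]_r) : dot u (delta_mx 0 i) = u 0 i.
  by rewrite -dot_deltal; apply: eq_bigr => j _; rewrite mulrC.
(* Testing against unit vectors in either vector part isolates the coordinates of the other. *)
have q0 : (reduction n).1.2 = 0.
  apply/rowP => i; have := conj (delta_mx 0 i, 0, 0).
  by rewrite /= map_mx0 map_delta_mx dot_deltal dot0r => ->; rewrite mxE.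
have p0 : (reduction n).1.1 = 0.
  apply/rowP => i; have := conj (0, delta_mx 0 i, 0).
  by rewrite /= map_mx0 map_delta_mx dot_deltar dot0l => <-; rewrite mxE.
have := kN _ Nn; rewrite /kappa /kappa3 p0 dot0l subr0.
by case: (reduction n) p0 q0 => [[p q] s] /= -> -> ->.
Qed.

(** Here [N] lies in the kernel of [reduction], which therefore factors through the quotient by [N]
    and maps it onto a group of order [3 ^ (2r + 1)]. *)
Lemma leq_index_inj N : injective (observe N) -> (3 ^ (2 * r + 1) <= group_index N)%N.
Proof.
move=> inj; rewrite -card_heis3.
apply: (leq_card_setT_surj (g := fun x : quotient_group N => reduction (repr x) : H3)).
  exact: observer_finite.
move=> y; have [x <-] := reduction_surj y; exists (quotient_map N x).
have /quotient_mapP/(observe_inj_kernel inj) := quotient_map_repr (quotient_map N x).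
rewrite reductionM gmulfV => /(congr1 (fun z => reduction (repr (quotient_map N x)) * z)%g).
by rewrite mulVKg mulg1.
Qed.

Lemma index_gt0 N : (0 < group_index N)%N.
Proof.
rewrite cardfs_gt0; apply/fset0Pn; exists 1%g.
by rewrite in_fset_set ?inE //; exact: observer_finite.
Qed.

(** * The two extremal observers *)

Definition kernel3 : normal_subgroup H.
Proof.
apply: (@NormalSubgroup _ (fun x => reduction x = 1%g)).
- exact: gmulf1.
- by move=> x y ex ey; rewrite reductionM ex ey mulg1.
- by move=> x ex; rewrite gmulfV /= ex invg1.
- by move=> x g ex; rewrite !reductionM ex mulg1 gmulfV mulgV.
Defined.

Lemma reduction_repr_inj :
  injective (fun x : quotient_group kernel3 => reduction (repr x) : H3).
Proof.
move=> x y e; rewrite -(quotient_map_repr x) -(quotient_map_repr y).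
by apply/quotient_mapP; rewrite /= reductionM gmulfV /= [reduction (repr x)]e mulVg.
Qed.

Lemma reduction_repr a : reduction (repr (quotient_map kernel3 a)) = reduction a.
Proof.
have /quotient_mapP := quotient_map_repr (quotient_map kernel3 a).
rewrite /= reductionM gmulfV => /(congr1 (fun z => reduction (repr (quotient_map kernel3 a)) * z)%g).
by rewrite mulVKg mulg1.
Qed.

Definition observer3 : observer phi.
Proof.
apply: (@Observer _ _ kernel3).
  exact: finite_setT_inj reduction_repr_inj.
by move=> x /= ex; rewrite reduction_dilation ex gmulf1.
Defined.

Lemma index_observer3 : group_index observer3 = (3 ^ (2 * r + 1))%N.
Proof.
rewrite /group_index (card_setT_bij reduction_repr_inj) ?card_heis3 // => y.
by have [x <-] := reduction_surj y; exists (quotient_map _ x); rewrite reduction_repr.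
Qed.

(** A twisted conjugacy in the quotient lifts to [H] up to an element of the kernel, which [kappa]
    does not see because it factors through [reduction]. *)
Lemma observer3_inj : injective (observe observer3).
Proof.
move=> x y; rewrite -(reidemeister_reprK x) -(reidemeister_reprK y) !observeE.
set a := reidemeister_repr x; set b := reidemeister_repr y.
move=> /reidemeister_classP[g e]; set h := repr g.
have {}e : quotient_map observer3 b = quotient_map observer3 (h * a * (phi h)^-1)%g.
  by rewrite !quotient_mapM -quotient_invE -induced_homE quotient_map_repr.
apply/dilation_class_eq.
transitivity (kappa (h * a * (phi h)^-1)%g).
  by apply/twisted_conjP; exists h.
by rewrite /kappa -(reduction_repr b) e reduction_repr.
Qed.

Definition whole_group : normal_subgroup H := @NormalSubgroup _ (fun=> True) I
  (fun _ _ _ _ => I) (fun _ _ => I) (fun _ _ _ => I).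

Lemma quotient_whole_group : [set: quotient_group whole_group] = [set 1%g].
Proof.
apply/seteqP; split=> // x _ /=; rewrite -(quotient_map_repr x).
exact/quotient_mapP.
Qed.

Definition trivial_observer : observer phi.
Proof.
apply: (@Observer _ _ whole_group) => //.
by rewrite quotient_whole_group; exact: finite_set1.
Defined.

Lemma index_trivial_observer : group_index trivial_observer = 1%N.
Proof. by rewrite /group_index quotient_whole_group fset_set1 cardfs1. Qed.

(** An injective observation would need index at least [3 ^ (2r + 1)], whereas this observer has
    index 1. *)
Lemma observe_trivial_cst x y :
  observe trivial_observer x = observe trivial_observer y.
Proof.
have [inj|] := observe_inj_or_cst trivial_observer; last exact.
have := leq_index_inj inj; rewrite index_trivial_observer addn1 expnS.
by have := expn_gt0 3 (2 * r); case: (3 ^ (2 * r))%N => // n _; lia.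
Qed.

End DilationObservers.

Theorem theorem10p3 (R : realType) (r : nat) (hr : (1 <= r)%N)
    (ind : fixed_point_index R (nilmanifold R r)) :
  let RT := dilation_trace ind in
  [/\ (forall B : nat, (1 <= B)%N ->
         visibility_profile RT B = (if (B < 3 ^ (2 * r + 1))%N then 1%N else 3%N)),
      (forall B : nat, (1 <= B)%N -> mass_profile RT B = 3%N),
      card_supp RT = 3%N /\
        (forall N : observer (@heis_dilation int r), visibility RT N <> 2%N) &
      [/\ dc RT = Some 1%N, cfc RT = Some 1%N &
          oc RT = Some (3 ^ (2 * r + 1))%N]].
Proof.
move=> RT; have RTE x : RT x = -1 by exact: dilation_traceE.
have mass N := index_mass_trace RTE N.
have triv B : (1 <= B)%N -> (group_index (trivial_observer r) <= B)%N.
  by rewrite index_trivial_observer.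
split.
- move=> B B1; apply: max_natE; case: ifP => ltB.
  + exists (trivial_observer r); first exact: triv.
    exact: (visibility_cst RTE (@observe_trivial_cst r)).
  + exists (observer3 r); first by rewrite /= index_observer3 leqNgt ltB.
    exact: (visibility_inj RTE (@observer3_inj r)).
  (* Below the threshold the index bound excludes injectivity, which leaves visibility 1. *)
  + move=> _ [N NB <-]; have [inj|cst] := observe_inj_or_cst N.
      have := leq_trans (leq_index_inj inj) NB; by rewrite leqNgt ltB.
    by rewrite (visibility_cst RTE cst).
  + move=> _ [N _ <-]; have [inj|cst] := observe_inj_or_cst N.
      by rewrite (visibility_inj RTE inj).
    by rewrite (visibility_cst RTE cst).
- move=> B B1; apply: max_natE; first by exists (trivial_observer r); [exact: triv|].
  by move=> _ [N _ <-]; rewrite mass.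
- split; first exact: card_supp_trace.
  move=> N; have [inj|cst] := observe_inj_or_cst N.
    by rewrite (visibility_inj RTE inj).
  by rewrite (visibility_cst RTE cst).
- split.
  (* No index is below 1, so the trivial observer is optimal once it qualifies. *)
  + apply: min_natE; last by move=> _ [N _ <-]; exact: index_gt0.
    exists (trivial_observer r); last exact: index_trivial_observer.
    exact: observed_trace_neq0 RTE _.
  + apply: min_natE; last by move=> _ [N _ <-]; exact: index_gt0.
    exists (trivial_observer r); last exact: index_trivial_observer.
    by rewrite /= mass (norm1_trace RTE).
  + apply: min_natE.
      exists (observer3 r); last exact: index_observer3.
      by move=> x y _ _; exact: observer3_inj.
    (* Every coefficient is -1, so the support is the whole set of classes and injectivity on it is
       plain injectivity. *)
    move=> _ [N inj <-]; apply: leq_index_inj => x y; apply: inj; rewrite inE /supp /= RTE //.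
Qed.
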